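(* Let $\mathcal{A} = \mathcal{A}^k_\ell(r)$ for integers $r,\ell \ge 2$ and $0 \le k \le \ell$. (i) If $\ell = 2$, then $\mathcal{A}$ is inductively factored. (ii) If $\ell = 3$, then $\mathcal{A}$ is nice. (iii) For $\ell \ge 3$, $\mathcal{A}$ is inductively factored if and only if $\ell -2 \le k \le \ell$. (iv) For $\ell \ge 4$, $\mathcal{A}$ is nice if and only if $\mathcal{A}$ is inductively factored.
   Context: For $r,\ell\ge 2$ and $0\le k\le \ell$, $\mathcal{A}^k_\ell(r)$ is the hyperplane arrangement in $\mathbb{C}^\ell$ with defining polynomial $x_1\cdots x_k\prod_{1\le i<j\le \ell,\ 0\le n<r}(x_i-\zeta^n x_j)$, where $\zeta$ is a primitive $r$-th root of unity. Arrangements are finite collections $\mathcal{A}$ of linear hyperplanes in a finite-dimensional vector space $V$. The intersection lattice $L(\mathcal{A})$ is the set of all intersections of subsets of $\mathcal{A}$ (including $V$ as the empty intersection); the rank is $r(X)=\operatorname{codim} X$. For $X \in L(\mathcal{A})$, the localization is $\mathcal{A}_X = \{H \in \mathcal{A} \mid X \subseteq H\}$ and the restriction is the arrangement $\mathcal{A}^X = \{X \cap H \mid H \in \mathcal{A}\setminus \mathcal{A}_X\}$ in $X$. Nice (= factored): a partition $\pi = (\pi_1,\ldots,\pi_s)$ of $\mathcal{A}$ (into non-empty blocks) is nice if (1) it is independent: for any choice $H_i \in \pi_i$ ($1\le i\le s$), $r(H_1\cap\dots\cap H_s)=s$; and (2) for each $X \in L(\mathcal{A})\setminus\{V\}$,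 the induced partition of $\mathcal{A}_X$ formed by the non-empty sets $\pi_i \cap \mathcal{A}_X$ has a block that is a singleton. $\mathcal{A}$ is nice if it admits a nice partition. Inductively factored: for $H_0\in\mathcal{A}$ put $\mathcal{A}'=\mathcal{A}\setminus\{H_0\}$ and $\mathcal{A}''=\mathcal{A}^{H_0}$. Given a partition $\pi=(\pi_1,\ldots,\pi_s)$ of $\mathcal{A}$ with $H_0\in\pi_1$ (blocks may be reordered), let $\pi'$ be the partition of $\mathcal{A}'$ by the non-empty sets $\pi_i\cap\mathcal{A}'$, let $\varrho:\mathcal{A}\setminus\pi_1\to\mathcal{A}''$, $H\mapsto H\cap H_0$, and let $\pi''=(\varrho(\pi_2),\ldots,\varrho(\pi_s))$. The class of inductively factored pairs is the smallest class of pairs $(\mathcal{A},\pi)$ (an arrangement with a partition) such that: (a) it contains the empty arrangement in $\mathbb{K}^\ell$ with the empty partition, for each $\ell\ge0$ ($\mathbb{K}$ the base field); (b) if there is $H_0\in\pi_1$ such that $\varrho$ is bijective and both $(\mathcal{A}',\pi')$ and $(\mathcal{A}'',\pi'')$ belong to the class, then so does $(\mathcal{A},\pi)$. $\mathcal{A}$ is inductively factored if $(\mathcal{A},\pi)$ belongs to this class for some $\pi$.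
   Formalization: Part (iii) is stated with the single case r = 2, ℓ = 3, k = 0 excluded, since there the claim fails: A^0_3(2) is the reflection arrangement of D_3 = A_3, which is supersolvable and hence inductively factored although k < ℓ − 2. *)

(* Defs.v *)
From HB Require Import structures.
From mathcomp Require Import all_boot all_order all_algebra finmap.
From mathcomp Require Import reals complex.

Set Implicit Arguments.
Unset Strict Implicit.
Unset Printing Implicit Defensive.

Import GRing.Theory.

Local Open Scope fset_scope.
Local Open Scope ring_scope.

Section Arrangements.
Variables (K : fieldType) (V : vectType K).

(* An arrangement is a pair (W, A): the ambient space W is a subspace of V and
   A is a finite set of hyperplanes of W.  The ambient space is explicit
   because the restriction to X is an arrangement in X. *)
Implicit Types (W X H : {vspace V}) (A B : {fset {vspace V}}).
Implicit Types (pi : {fset {fset {vspace V}}}).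

Definition is_arrangement W A : Prop :=
  forall H, H \in A -> (H <= W)%VS /\ \dim W = (\dim H).+1.

Definition rank W X : nat := (\dim W - \dim X)%N.

Definition in_lattice W A X : Prop :=
  exists2 B, B `<=` A & X = (W :&: \bigcap_(H <- B) H)%VS.

Definition localization A X : {fset {vspace V}} :=
  [fset H in A | (X <= H)%VS].

Definition restriction A X : {fset {vspace V}} :=
  [fset (H :&: X)%VS | H in A `\` localization A X].

Definition is_partition pi A : Prop :=
  [/\ fset0 \notin pi, trivIfset pi & fcover pi = A].

(* A choice of one hyperplane in each block is a function c on blocks. *)
Definition independent W pi : Prop :=
  forall c : {fset {vspace V}} -> {vspace V},
    (forall B, B \in pi -> c B \in B) ->
    rank W (W :&: \bigcap_(B <- pi) c B)%VS = #|` pi|.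

Definition induced_partition pi A X : {fset {fset {vspace V}}} :=
  [fset B `&` localization A X | B in pi] `\ fset0.

Definition nice_partition W A pi : Prop :=
  [/\ is_partition pi A,
      independent W pi
    & forall X, in_lattice W A X -> X <> W ->
        exists2 B, B \in induced_partition pi A X & #|` B| = 1%N].

Definition nice W A : Prop := exists pi, nice_partition W A pi.

Definition del_partition pi A H0 : {fset {fset {vspace V}}} :=
  [fset B `&` (A `\ H0) | B in pi] `\ fset0.

Definition restr_partition pi B1 H0 : {fset {fset {vspace V}}} :=
  [fset [fset (H :&: H0)%VS | H in B]
     | B : {fset {vspace V}} in pi `\ B1].

(* rho : A \ B1 -> A^H0, H |-> H :&: H0 *)
Definition rho_bijective A B1 H0 : Prop :=
  {in A `\` B1 &, injective (fun H => (H :&: H0)%VS)} /\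
  [fset (H :&: H0)%VS | H in A `\` B1] = restriction A H0.

Inductive ind_factored_pair :
  {vspace V} -> {fset {vspace V}} -> {fset {fset {vspace V}}} -> Prop :=
| IndFactored0 W : ind_factored_pair W fset0 fset0
| IndFactoredS W A pi B1 H0 :
    is_arrangement W A -> is_partition pi A ->
    B1 \in pi -> H0 \in B1 ->
    rho_bijective A B1 H0 ->
    ind_factored_pair W (A `\ H0) (del_partition pi A H0) ->
    ind_factored_pair H0 (restriction A H0) (restr_partition pi B1 H0) ->
    ind_factored_pair W A pi.

Definition inductively_factored W A : Prop :=
  exists pi, ind_factored_pair W A pi.

End Arrangements.

Section IntermediateArrangement.
Variables (K : fieldType) (l : nat).

(* The kernel {x | x *m a = 0} of the linear form with coefficient column a. *)
Definition hyperplane (a : 'cV[K]_l) : {vspace 'rV[K]_l} :=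
  lker (linfun (mulmxr a : 'rV[K]_l -> 'rV[K]_1)).

Definition coord_hyp (i : 'I_l) : {vspace 'rV[K]_l} :=
  hyperplane (delta_mx i 0).

Definition diff_hyp (c : K) (i j : 'I_l) : {vspace 'rV[K]_l} :=
  hyperplane (delta_mx i 0 - c *: delta_mx j 0).

(* Coordinates are numbered from 0, so x_1, ..., x_k are those of index < k. *)
Definition Akl (r k : nat) (zeta : K) : {fset {vspace 'rV[K]_l}} :=
  [fset coord_hyp i | i in [pred i : 'I_l | (i < k)%N]] `|`
  [fset diff_hyp (zeta ^+ t.2) t.1.1 t.1.2
     | t : 'I_l * 'I_l * 'I_r in
         [pred t : 'I_l * 'I_l * 'I_r | (t.1.1 < t.1.2)%N]].

Lemma coord_hypE (i : 'I_l) (x : 'rV[K]_l) :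
  (x \in coord_hyp i) = (x 0 i == 0).
Proof.
rewrite memv_ker lfunE /= -colE; apply/eqP/eqP => [/rowP/(_ 0)|xi0].
  by rewrite !mxE.
by apply/rowP => j; rewrite !mxE.
Qed.

Lemma diff_hypE (c : K) (i j : 'I_l) (x : 'rV[K]_l) :
  (x \in diff_hyp c i j) = (x 0 i - c * x 0 j == 0).
Proof.
rewrite memv_ker lfunE /= mulmxBr -scalemxAr -!colE.
apply/eqP/eqP => [/rowP/(_ 0)|xij0].
  by rewrite !mxE.
by apply/rowP => m; rewrite !mxE.
Qed.

Lemma hyperplane_codim1 (a : 'cV[K]_l) : a != 0 ->
  \dim {:'rV[K]_l} = (\dim (hyperplane a)).+1.
Proof.
move=> a0; pose f : 'Hom('rV[K]_l, 'rV[K]_1) :=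
  linfun (mulmxr a : 'rV[K]_l -> 'rV[K]_1).
have := limg_ker_dim f fullv.
rewrite capfv -/(hyperplane a) => <-; rewrite -[RHS]addn1; congr (_ + _)%N.
have le1 : (\dim (limg f) <= 1)%N.
  by rewrite (leq_trans (dimvS (subvf _))) // dimvf /dim /= mul1n.
have gt0 : (0 < \dim (limg f))%N.
  rewrite lt0n dimv_eq0; apply/negP => /eqP f0; case/negP: a0; apply/eqP.
  apply/colP => i; have := memv_img f (memvf (delta_mx 0 i)).
  rewrite f0 memv0 lfunE /= -rowE => /eqP/rowP/(_ 0).
  by rewrite !mxE.
by apply/eqP; rewrite eqn_leq le1 gt0.
Qed.

Lemma Akl_arrangement (r k : nat) (zeta : K) :
  is_arrangement fullv (Akl r k zeta).
Proof.
move=> H; rewrite inE => /orP[] /imfsetP[] /=.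
  move=> i _ ->; split; first exact: subvf.
  apply: hyperplane_codim1; apply/eqP => /colP/(_ i).
  by rewrite !mxE !eqxx => /eqP; rewrite oner_eq0.
move=> [[i j] n] /= ltij ->; split; first exact: subvf.
apply: hyperplane_codim1; apply/eqP => /colP/(_ i).
have /negPf nij : i != j by rewrite -val_eqE /= (ltn_eqF ltij).
by rewrite !mxE !eqxx nij mulr0 subr0 => /eqP; rewrite oner_eq0.
Qed.

End IntermediateArrangement.

(* Main.v *)
Require Import Defs.
From mathcomp Require Import all_boot all_order all_algebra finmap.
From mathcomp Require Import reals complex.
From mathcomp Require Import zify.

Set Implicit Arguments.
Unset Strict Implicit.
Unset Printing Implicit Defensive.

Import GRing.Theory.

(** Write [E_ij(c)] for [x_i = c x_j] with [c^r = 1], and [l - 2 <= k] first.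
    If [k >= l - 1], grouping the hyperplanes by the largest coordinate they
    involve gives a supersolvable partition, and those are inductively factored:
    delete the last block one hyperplane at a time. If [k = l - 2], move the
    [E_(l-1,l)(c)] with [c <> 1] to the block of index [l - 1]; each of them
    restricts to a supersolvable arrangement, and deleting all of them leaves one.

    If [l >= 4] and [k < l - 2], color hyperplanes by their block in a nice
    partition. Every rank 2 flat with at least two hyperplanes carries exactly
    two colors. Take three coordinates [i, j, m > k] and a further one [t]. The
    singleton block of the flat [x_i = x_j = x_m = 0] forces a color [x] common
    to the pairs [ij], [im] and [jm]; let [x], [z] be the two colors of [ij].
    The rank 2 flats through coordinate [t] then force all [E_it], [E_jt] to
    share one further color [u], so that [x_t = 0] must belong to the
    arrangement, in a fourth color, and four blocks meet a flat of rank 3.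

    If [l = 3] and [k = 0] there is an explicit nice partition, but for [r >= 3]
    no hyperplane [H0] has a bijective restriction map. *)

(** What breaks at [k = l - 2] is one flat: two hyperplanes E_(l-1,l)(c) meet in x_(l-1) = x_l = 0,
    and the only hyperplane on fewer coordinates through it would be x_(l-1) = 0, which is absent.
    Moving those with c <> 1 repairs this: on E_(l-1,l)(a) with a <> 1, the hyperplane E_(l-1,l)(1)
    cuts out x_l = 0, so the restriction is the full monomial arrangement in l - 1 variables.
    Inductively factored pairs are nice, so for l >= 4 a single obstruction to niceness decides both
    equivalences. For l = 3 niceness obstructs nothing, and the bijectivity of the restriction map
    has to fail instead. Both arguments rest on triangles: for distinct i, j, m the flat x_i = c x_j
    = c d x_m lies in exactly three hyperplanes, and these carry exactly two colors. *)

Section NicePartitions.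
Local Open Scope fset_scope.
Local Open Scope ring_scope.
Variables (K : fieldType) (V : vectType K).
Implicit Types (W X H : {vspace V}) (A B : {fset {vspace V}}).
Implicit Types (pi : {fset {fset {vspace V}}}).

(** * Codimension of intersections; nice partitions in terms of partial choices *)

Lemma memv_bigcap (I : Type) (s : seq I) (F : I -> {vspace V}) v :
  (v \in \bigcap_(i <- s) F i)%VS = all (fun i => v \in F i) s.
Proof. by elim: s => [|i s IH]; rewrite ?big_nil ?memvf // big_cons memv_cap IH. Qed.

Lemma dim_cap_hyperplane W H U :
  (H <= W)%VS -> \dim W = (\dim H).+1 -> (U <= W)%VS ->
  (\dim U <= (\dim (U :&: H)).+1)%N.
Proof.
move=> HW dW UW; have := dimv_sum_cap U H.
have : (\dim (U + H) <= \dim W)%N by apply: dimvS; rewrite subv_add UW.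
rewrite dW => le1 eq1; rewrite -(leq_add2r (\dim H)) -eq1.
by rewrite addnC addSnnS leq_add2l.
Qed.

Lemma dim_bigcap_ge (I : eqType) (s : seq I) (F : I -> {vspace V}) W U :
  {in s, forall i, (F i <= W)%VS /\ \dim W = (\dim (F i)).+1} -> (U <= W)%VS ->
  (\dim U <= \dim (U :&: \bigcap_(i <- s) F i) + size s)%N.
Proof.
move=> hF UW; elim: s hF => [|i s IH] hF; first by rewrite big_nil capvf addn0.
have [FW dF] := hF i (mem_head _ _).
apply: leq_trans (IH _) _ => [j js|]; first by apply: hF; rewrite inE js orbT.
rewrite big_cons /= addnS -addSn leq_add2r (capvC (F i)) capvA.
apply: (dim_cap_hyperplane FW dF).
exact: subv_trans (capvSl _ _) UW.
Qed.

(** A flat is recovered from the members containing it, so it can be passed to a deletion or a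
    restriction without naming a subset that cuts it out. *)
Lemma in_latticeP W A X : is_arrangement W A ->
  in_lattice W A X <->
  (X <= W)%VS /\
  (forall v, v \in W -> (forall H, H \in A -> (X <= H)%VS -> v \in H) -> v \in X).
Proof.
move=> arrA; split=> [[B /fsubsetP BA ->]|[XW XP]].
  split=> [|v vW vP]; first exact: capvSl.
  rewrite memv_cap vW memv_bigcap; apply/allP => H HB.
  apply: vP; first exact: BA.
  apply/subvP => u; rewrite memv_cap memv_bigcap => /andP[_ /allP]; exact.
exists (localization A X); first exact: fset_sub.
apply/vspaceP => v; rewrite memv_cap memv_bigcap; apply/idP/andP.
  move=> vX; split; first exact: (subvP XW).
  by apply/allP => H; rewrite !inE => /andP[_ /subvP]; apply.
move=> [vW /allP vP]; apply: XP => // H HA XH.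
by apply: vP; rewrite !inE HA.
Qed.

Lemma in_lattice_bigcap W A s : {subset s <= A} ->
  in_lattice W A (W :&: \bigcap_(H <- s) H)%VS.
Proof.
move=> sA; exists [fset H in s].
  by apply/fsubsetP => H; rewrite !inE => /sA.
apply/vspaceP => v; rewrite !memv_cap !memv_bigcap; congr (_ && _).
by apply/allP/allP => vs H Hs; apply: vs; move: Hs; rewrite !inE.
Qed.

Lemma partition_disjoint pi A B B' H : is_partition pi A ->
  B \in pi -> B' \in pi -> H \in B -> H \in B' -> B = B'.
Proof.
move=> [_ /trivIfsetP tpi _] Bpi B'pi HB HB'; apply/eqP/idPn => neqB.
by have /fdisjointP/(_ H HB) := tpi B B' Bpi B'pi neqB; rewrite HB'.
Qed.

Lemma partition_mem pi A H : is_partition pi A ->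
  reflect (exists2 B, B \in pi & H \in B) (H \in A).
Proof.
move=> [_ _ <-]; rewrite /fcover.
apply: (iffP (bigfcupP _ _ _ _)) => [[B /andP[? _] ?]|[B ? ?]].
  by exists B.
by exists B; rewrite ?andbT.
Qed.

(** Independence is later applied to a few blocks at a time, which a choice function on all blocks
    does not express directly. *)
Definition partial_transversal pi (L : seq {vspace V}) : Prop :=
  [/\ uniq L, {subset L <= fcover pi} &
    forall B H H', B \in pi -> H \in L -> H' \in L -> H \in B -> H' \in B ->
      H = H'].

(** For independence, extend [L] to a choice on all blocks. Each hyperplane lowers the dimension by
    at most one, and the full choice loses exactly one per block, so [L] already loses one per
    member. *)
Lemma nice_partitionP W A pi : is_arrangement W A ->
  nice_partition W A pi <->
  [/\ is_partition pi A,
      forall L, partial_transversal pi L ->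
        \dim W = (\dim (W :&: \bigcap_(H <- L) H)%VS + size L)%N
    & forall X, in_lattice W A X -> X <> W ->
        exists B H, [/\ B \in pi, H \in B, (X <= H)%VS &
          forall H', H' \in B -> (X <= H')%VS -> H' = H]].
Proof.
move=> arrA; split=> [] [parpi indep nicepi]; split=> //.
- move=> L [uL LA LB].
  have LA' : {subset L <= A} by case: parpi => _ _ <-.
  (* The member of [L] in [B] if there is one, otherwise the first element of [B]; the default [0]
     is never reached on a block, since blocks are non-empty. *)
  pose c B := head (head 0%VS (B : {fset _})) [seq H <- L | H \in B].
  have cL B H : B \in pi -> H \in L -> H \in B -> c B = H.
    move=> Bpi HL HB; rewrite /c.
    have : H \in [seq H <- L | H \in B] by rewrite mem_filter HB.
    case def_s: [seq _ <- _ | _] => [|H' s] // _ /=.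
    have : H' \in [seq H <- L | H \in B] by rewrite def_s mem_head.
    by rewrite mem_filter => /andP[H'B H'L]; apply: LB HB.
  have cB B : B \in pi -> c B \in B.
    move=> Bpi; rewrite /c; case def_s: [seq _ <- _ | _] => [|H' s] /=.
      case: parpi => npi _ _; case def_B: (enum_fset B) => [|H s] /=.
        suff B0 : B = fset0 by rewrite -B0 Bpi in npi.
        by apply/fsetP => H; rewrite !inE -[_ \in B]/(H \in enum_fset B) def_B.
      by rewrite -[_ \in B]/(H \in enum_fset B) def_B mem_head.
    have : H' \in [seq H <- L | H \in B] by rewrite def_s mem_head.
    by rewrite mem_filter => /andP[].
  pose P (B : {fset {vspace V}}) := has (mem B) L.
  have hypc : {in pi, forall B, (c B <= W)%VS /\ \dim W = (\dim (c B)).+1}.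
    by move=> B Bpi; apply: arrA; apply/(partition_mem _ parpi); exists B; auto.
  have permL : perm_eq L [seq c B | B <- pi & P B].
    apply: uniq_perm => //.
      rewrite map_inj_in_uniq ?filter_uniq ?fset_uniq // => B B'.
      rewrite !mem_filter => /andP[PB Bpi] /andP[PB' B'pi] eqc.
      apply: (partition_disjoint parpi Bpi B'pi (cB B Bpi)).
      by rewrite eqc cB.
    move=> H; apply/idP/mapP => [HL|[B]].
      have /(partition_mem _ parpi)[B Bpi HB] := LA' H HL.
      exists B; last by rewrite (cL B H).
      by rewrite mem_filter Bpi andbT; apply/hasP; exists H.
    rewrite mem_filter => /andP[/hasP[H' H'L H'B] Bpi] ->.
    by rewrite (cL B H').
  have szL : size L = count P pi by rewrite (perm_size permL) size_map size_filter.
  rewrite (perm_big _ permL) /= big_map big_filter.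
  have := indep c cB; rewrite /rank.
  rewrite (bigID P) /= -[X in (_ :&: (_ :&: X))%VS]big_filter capvA.
  set U := (W :&: _)%VS.
  have UW : (U <= W)%VS := capvSl _ _.
  have := @dim_bigcap_ge _ [seq B <- pi | ~~ P B] c W U _ UW.
  have := @dim_bigcap_ge _ [seq B <- pi | P B] c W W _ (subvv _).
  have szpi : #|` pi| = (count P pi + count (predC P) pi)%N.
    by rewrite count_predC.
  have sF Q : {in [seq B <- pi | Q B], forall B,
      (c B <= W)%VS /\ \dim W = (\dim (c B)).+1}.
    by move=> B; rewrite mem_filter => /andP[_ /hypc].
  rewrite szpi szL !size_filter => /(_ (sF _)) le1 /(_ (sF _)) le2.
  move: le1 le2 (dimvS UW); rewrite [X in (W :&: X)%VS]big_filter -/U.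
  rewrite -[count (fun B => ~~ P B) pi]/(count (predC P) pi) !big_filter.
  set a := \dim (U :&: _)%VS; set n1 := count P pi; set n2 := count _ pi.
  lia.
- move=> X latX XW; have [B] := nicepi X latX XW.
  rewrite !inE => /andP[_ /imfsetP[/= B0 B0pi ->]] /eqP/cardfs1P[H BH].
  have : H \in [fset H] by rewrite inE.
  rewrite -BH !inE => /and3P[HB0 HA XH]; exists B0, H; split=> // H' H'B0 XH'.
  have : H' \in [fset H].
    by rewrite -BH !inE H'B0 XH' andbT /=; apply/(partition_mem _ parpi); exists B0.
  by rewrite inE => /eqP.
- move=> c cB.
  have tL : partial_transversal pi [seq c B | B <- pi].
    split.
    + rewrite map_inj_in_uniq ?fset_uniq // => B B' Bpi B'pi eqc.
      by apply: (partition_disjoint parpi Bpi B'pi (cB B Bpi)); rewrite eqc cB.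
    + case: (parpi) => _ _ -> H /mapP[B Bpi ->].
      by apply/(partition_mem _ parpi); exists B; auto.
    + move=> B _ _ Bpi /mapP[B1 B1pi ->] /mapP[B2 B2pi ->] H1 H2.
      rewrite -(partition_disjoint parpi Bpi B1pi H1 (cB _ B1pi)).
      by rewrite -(partition_disjoint parpi Bpi B2pi H2 (cB _ B2pi)).
  have := indep _ tL; rewrite big_map size_map /rank /= => ->.
  by rewrite addKn.
- move=> X latX XW; have [B [H [Bpi HB XH HP]]] := nicepi X latX XW.
  have BX : B `&` localization A X = [fset H].
    apply/fsetP => H'; rewrite !inE; apply/idP/eqP => [/and3P[? _ ?]|->].
      exact: HP.
    by rewrite HB XH andbT /=; apply/(partition_mem _ parpi); exists B.
  exists [fset H]; last by rewrite cardfs1.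
  rewrite !inE; apply/andP; split.
    by apply/eqP => /fsetP/(_ H); rewrite !inE eqxx.
  by apply/imfsetP; exists B.
Qed.
End NicePartitions.

(** * Inductively factored pairs are nice *)

Section InductivelyFactoredNice.
Local Open Scope fset_scope.
Local Open Scope ring_scope.
Variables (K : fieldType) (V : vectType K).
Implicit Types (W X H : {vspace V}) (A B : {fset {vspace V}}).
Implicit Types (pi : {fset {fset {vspace V}}}).

Lemma hyperplane_le_eq W A H H' : is_arrangement W A ->
  H \in A -> H' \in A -> (H <= H')%VS -> H = H'.
Proof.
move=> arrA /arrA[_ dH] /arrA[_ dH'] HH'; apply/eqP; rewrite eqEdim HH' /=.
by rewrite -ltnS -dH -dH'.
Qed.

Lemma cap_hyperplanes_codim1 W A H H' : is_arrangement W A ->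
  H \in A -> H' \in A -> H != H' -> \dim H = (\dim (H' :&: H)).+1.
Proof.
move=> arrA HA H'A neqH; have [HW dH] := arrA H HA; have [H'W dH'] := arrA H' H'A.
apply/eqP; rewrite eqn_leq capvC (dim_cap_hyperplane H'W dH' HW) /=.
rewrite ltnNge; apply: contra neqH => le; apply/eqP.
apply: (hyperplane_le_eq arrA) => //.
suff <- : (H :&: H')%VS = H by apply: capvSr.
by apply/eqP; rewrite eqEdim capvSl.
Qed.

Lemma restrictionP W A H0 Y : is_arrangement W A -> H0 \in A ->
  reflect (exists H, [/\ H \in A, H != H0 & Y = (H :&: H0)%VS])
    (Y \in restriction A H0).
Proof.
move=> arrA H0A; apply: (iffP idP) => [/imfsetP[H /=]|[H [HA neqH ->]]].
  rewrite !inE negb_and => /andP[/orP[/negP//|nle] HA] ->; exists H; split=> //.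
  by apply: contraNneq nle => ->.
apply/imfsetP; exists H => //=; rewrite !inE HA andbT /=.
by apply: contra neqH => le; rewrite (hyperplane_le_eq arrA H0A HA).
Qed.

Lemma is_arrangement_restriction W A H0 : is_arrangement W A -> H0 \in A ->
  is_arrangement H0 (restriction A H0).
Proof.
move=> arrA H0A Y /(restrictionP _ arrA H0A)[H [HA neqH ->]].
split; first exact: capvSr.
by apply: (cap_hyperplanes_codim1 arrA); rewrite // eq_sym.
Qed.

Lemma is_arrangementD1 W A H0 : is_arrangement W A -> is_arrangement W (A `\ H0).
Proof. by move=> arrA H; rewrite !inE => /andP[_ /arrA]. Qed.

Lemma del_partitionP pi A H0 B' : is_partition pi A -> B' \in del_partition pi A H0 ->
  exists2 B, B \in pi & forall H, (H \in B') = (H != H0) && (H \in B).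
Proof.
move=> parpi; rewrite !inE => /andP[_ /imfsetP[/= B Bpi ->]]; exists B => // H.
rewrite !inE andbC -andbA; congr (_ && _); case HB : (H \in B); rewrite ?andbF //.
by rewrite andbT; apply/(partition_mem _ parpi); exists B.
Qed.

Lemma del_partition_transversal pi A H0 L : is_partition pi A ->
  is_partition (del_partition pi A H0) (A `\ H0) ->
  H0 \notin L -> partial_transversal pi L -> partial_transversal (del_partition pi A H0) L.
Proof.
move=> parpi parpi' H0L [uL LA LB]; split=> //.
  case: parpi' => _ _ -> H HL; case: (parpi) => _ _ eqA.
  rewrite !inE -eqA LA // andbT; by apply: contraNneq H0L => <-.
move=> B' H H' /(del_partitionP parpi)[B Bpi B'B] HL H'L.
by rewrite !B'B => /andP[_ HB] /andP[_ H'B]; apply: LB HB H'B.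
Qed.

(** [H0] already represents [B1], so [L] avoids [B1]; injectivity of the restriction map then takes
    each trace back to one hyperplane, hence to one block of [pi]. *)
Lemma restr_partition_transversal W A pi B1 H0 L :
  is_arrangement W A -> is_partition pi A -> B1 \in pi -> H0 \in B1 ->
  rho_bijective A B1 H0 ->
  is_partition (restr_partition pi B1 H0) (restriction A H0) ->
  partial_transversal pi (H0 :: L) ->
  partial_transversal (restr_partition pi B1 H0) [seq (H :&: H0)%VS | H <- L].
Proof.
move=> arrA parpi B1pi H0B1 [rinj rsurj] parpi'' [/andP[/= H0L uL] LA LB].
have LA' H : H \in L -> H \in A `\` B1.
  move=> HL; rewrite inE; apply/andP; split; last first.
    by case: (parpi) => _ _ <-; apply: LA; rewrite inE HL orbT.
  apply: contraNN H0L => HB1.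
  by rewrite (LB B1 H0 H) ?mem_head // inE HL orbT.
split.
- by rewrite map_inj_in_uniq // => H H' /LA' HA /LA' H'A; apply: rinj.
- case: parpi'' => _ _ -> _ /mapP[H /LA' HL ->].
  by rewrite -rsurj; apply/imfsetP; exists H.
move=> B _ _ /imfsetP[/= C] /fsetD1P[neqC Cpi] -> /mapP[H HL ->] /mapP[H' H'L ->].
have CA H2 : H2 \in C -> H2 \in A `\` B1.
  move=> H2C; rewrite inE; apply/andP; split.
    apply: contra neqC => H2B1.
    by rewrite (partition_disjoint parpi Cpi B1pi H2C H2B1).
  by apply/(partition_mem _ parpi); exists C.
move=> /imfsetP[/= H2 H2C eqH] /imfsetP[/= H3 H3C eqH'].
have {}eqH : H = H2 by apply: rinj eqH; [apply: LA' | apply: CA].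
have {}eqH' : H' = H3 by apply: rinj eqH'; [apply: LA' | apply: CA].
by rewrite (LB C H H') // ?inE ?HL ?H'L ?orbT // ?eqH ?eqH'.
Qed.

(** Both conditions split along [H0]. A partial choice containing [H0] is tested in the restriction,
    any other in the deletion. A flat not inside [H0] has the same localization in the deletion; the
    flat [H0] has [B1] as its singleton; a smaller flat inside [H0] gets its singleton from the
    restriction, lifted by injectivity. *)
Theorem ind_factored_nice W A pi :
  ind_factored_pair W A pi -> nice_partition W A pi.
Proof.
elim=> {W A pi} [W|W A pi B1 H0 arrA parpi B1pi H0B1 rbij _ niceD _ niceR].
  split.
  - split; [by rewrite inE | by apply/trivIfsetP => B; rewrite inE |].
    by rewrite /fcover big_seq_fset0.
  - by move=> c _; rewrite big_seq_fset0 capvf /rank subnn cardfs0.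
  - move=> X [B]; rewrite fsubset0 => /eqP -> ->.
    by rewrite big_seq_fset0 capvf.
have H0A : H0 \in A by apply/(partition_mem _ parpi); exists B1.
have arrD := @is_arrangementD1 W A H0 arrA.
have arrR := is_arrangement_restriction arrA H0A.
have [H0W dH0] := arrA H0 H0A.
apply/(nice_partitionP _ arrA); split=> //.
- move=> L tL; have [H0L|H0L] := boolP (H0 \in L); last first.
    have [parD indD _] := (nice_partitionP _ arrD).1 niceD.
    by apply: indD; apply: del_partition_transversal.
  have permL := perm_to_rem H0L.
  have tL' : partial_transversal pi (H0 :: rem H0 L).
    case: tL => uL LA LB; split; first by rewrite -(perm_uniq permL).
      by move=> H; rewrite -(perm_mem permL); apply: LA.
    by move=> B H H'; rewrite -!(perm_mem permL); apply: LB.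
  have [parR indR _] := (nice_partitionP _ arrR).1 niceR.
  have := indR _ (restr_partition_transversal arrA parpi B1pi H0B1 rbij parR tL').
  rewrite size_map big_map dH0 => ->.
  rewrite (perm_big _ permL) big_cons (perm_size permL) /= addnS.
  congr ((\dim _) + _).+1; apply/vspaceP => v.
  rewrite !memv_cap !memv_bigcap andbA.
  have -> : (v \in W) && (v \in H0) = (v \in H0).
    by apply/andb_idl => /(subvP H0W).
  case vH0 : (v \in H0) => //=; apply: eq_all => H.
  by rewrite memv_cap vH0 andbT.
- move=> X latX neqX.
  have [XH0|XH0] := boolP (X <= H0)%VS; last first.
    have [parD _ latD] := (nice_partitionP _ arrD).1 niceD.
    have latXD : in_lattice W (A `\ H0) X.
      apply/(in_latticeP _ arrD); have [XW XP] := (in_latticeP _ arrA).1 latX.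
      split=> // v vW vP; apply: XP => // H HA XH; apply: vP => //.
      by rewrite !inE HA andbT; apply: contraNneq XH0 => <-.
    have [B' [H [B'pi HB' XH HP]]] := latD X latXD neqX.
    have [B Bpi B'B] := del_partitionP parpi B'pi.
    exists B, H; split=> // [|H' H'B XH'].
      by move: HB'; rewrite B'B => /andP[].
    by apply: HP => //; rewrite B'B H'B andbT; apply: contraNneq XH0 => <-.
  have [parR _ latR] := (nice_partitionP _ arrR).1 niceR.
  have [eqX|/eqP neqX0] := eqVneq X H0.
    exists B1, H0; split=> // H' H'B1; rewrite eqX => le.
    apply/esym/(hyperplane_le_eq arrA) => //.
    by apply/(partition_mem _ parpi); exists B1.
  have latXR : in_lattice H0 (restriction A H0) X.
    apply/(in_latticeP _ arrR); have [XW XP] := (in_latticeP _ arrA).1 latX.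
    split=> // v vH0 vP; apply: XP => [|H HA XH]; first exact: (subvP H0W).
    have [->//|neqH] := eqVneq H H0.
    have : v \in (H :&: H0)%VS.
      apply: vP; first by apply/(restrictionP _ arrA H0A); exists H.
      by rewrite subv_cap XH.
    by rewrite memv_cap => /andP[].
  have [B'' [Y [B''pi YB'' XY YP]]] := latR X latXR neqX0.
  case/imfsetP: B''pi => /= B /fsetD1P[neqB Bpi] eqB''.
  have BA H2 : H2 \in B -> H2 \in A `\` B1.
    move=> H2B; rewrite inE; apply/andP; split.
      apply: contra neqB => H2B1.
      by rewrite (partition_disjoint parpi Bpi B1pi H2B H2B1).
    by apply/(partition_mem _ parpi); exists B.
  move: YB''; rewrite eqB'' => /imfsetP[/= H HB eqY].
  exists B, H; split=> // [|H' H'B XH'].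
    by apply: subv_trans XY _; rewrite eqY capvSl.
  case: rbij => rinj _; apply: rinj; rewrite ?BA // -eqY; apply: YP.
    by rewrite eqB''; apply/imfsetP; exists H'.
  by rewrite subv_cap XH'.
Qed.

End InductivelyFactoredNice.

(** * Colored families of hyperplanes and supersolvable partitions *)

Section ColoredFamilies.
Local Open Scope fset_scope.
Local Open Scope ring_scope.
Variables (K : fieldType) (V : vectType K).
Implicit Types (W X H : {vspace V}) (A B D : {fset {vspace V}}).
Implicit Types (b : {vspace V} -> nat).

(** Iterated restrictions are kept as families [D] of subspaces of [V] traced on a smaller [W], so
    that one coloring of the original hyperplanes serves all of them. *)
Definition traces W D : {fset {vspace V}} := [fset (H :&: W)%VS | H in D].

Definition fiber b D (n : nat) : {fset {vspace V}} := [fset H in D | b H == n].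

(** Indexing by members of [D] instead of colors keeps empty blocks out, also after deletions. *)
Definition color_blocks b W D : {fset {fset {vspace V}}} :=
  [fset traces W (fiber b D (b H)) | H in D].

Definition hyperplane_family W D : Prop :=
  {in D &, injective (fun H => (H :&: W)%VS)} /\
  {in D, forall H, \dim W = (\dim (H :&: W)).+1}.

Lemma tracesP W D Y :
  reflect (exists2 H, H \in D & Y = (H :&: W)%VS) (Y \in traces W D).
Proof. exact: imfsetP. Qed.

Lemma in_fiber b D n H : (H \in fiber b D n) = (H \in D) && (b H == n).
Proof. by rewrite !inE. Qed.

Lemma mem_traces W D D1 H : {in D &, injective (fun H => (H :&: W)%VS)} ->
  D1 `<=` D -> H \in D -> ((H :&: W)%VS \in traces W D1) = (H \in D1).
Proof.
move=> injW /fsubsetP D1D HD; apply/tracesP/idP => [[H' H'D1 eqH]|HD1].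
  by rewrite (injW H H' HD (D1D _ H'D1) eqH).
by exists H.
Qed.

Lemma traces_arrangement W D : hyperplane_family W D ->
  is_arrangement W (traces W D).
Proof.
by move=> [_ dimD] _ /tracesP[H HD ->]; split; [exact: capvSr | exact: dimD].
Qed.

Lemma fiber_sub b D n : fiber b D n `<=` D.
Proof. exact: fset_sub. Qed.

Lemma color_blocks_partition b W D : hyperplane_family W D ->
  is_partition (color_blocks b W D) (traces W D).
Proof.
move=> [injD _]; split.
- apply/negP => /imfsetP[/= H HD /fsetP/(_ (H :&: W)%VS)].
  by rewrite inE (mem_traces injD (fiber_sub _ _ _)) // in_fiber HD eqxx.
- apply/trivIfsetP => _ _ /imfsetP[/= H HD ->] /imfsetP[/= H' H'D ->] neq.
  apply/fdisjointP => Y /tracesP[H2]; rewrite in_fiber => /andP[H2D /eqP eqb] ->.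
  rewrite (mem_traces injD (fiber_sub _ _ _)) // in_fiber H2D /=.
  by apply: contra neq => /eqP eqb'; rewrite -eqb -eqb'.
apply/fsetP => Y; apply/bigfcupP/tracesP => /= [[B]|[H HD ->]].
  rewrite andbT => /imfsetP[/= H HD ->] /tracesP[H'].
  by rewrite in_fiber => /andP[H'D _] ->; exists H'.
exists (traces W (fiber b D (b H))).
  by rewrite andbT; apply/imfsetP; exists H.
by rewrite (mem_traces injD (fiber_sub _ _ _)) // in_fiber HD eqxx.
Qed.

Lemma capvCA_trace W H H0 : ((H :&: W) :&: (H0 :&: W) = H :&: (H0 :&: W))%VS.
Proof. by rewrite -capvA; congr (_ :&: _)%VS; rewrite capvC -capvA capvv. Qed.

Lemma traces_trace W D H0 :
  [fset (Y :&: (H0 :&: W))%VS | Y in traces W D] = traces (H0 :&: W)%VS D.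
Proof.
apply/fsetP => Y; apply/imfsetP/tracesP => [[_ /= /tracesP[H HD ->] ->]|[H HD ->]].
  by exists H => //; rewrite capvCA_trace.
by exists (H :&: W)%VS; rewrite ?capvCA_trace //=; apply/tracesP; exists H.
Qed.

(* [b H <> b H0] rather than [b H < b H0]: the removed hyperplane need not lie
   in the last block. *)
Lemma ind_factored_step b W D H0 : hyperplane_family W D -> H0 \in D ->
  let D' := [fset H in D | b H != b H0] in
  {in D' &, injective (fun H => (H :&: (H0 :&: W))%VS)} ->
  (forall H, H \in D -> H != H0 -> b H = b H0 ->
     exists2 H', H' \in D' & (H :&: (H0 :&: W) = H' :&: (H0 :&: W))%VS) ->
  ind_factored_pair W (traces W (D `\ H0)) (color_blocks b W (D `\ H0)) ->
  ind_factored_pair (H0 :&: W)%VS (traces (H0 :&: W)%VS D')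
    (color_blocks b (H0 :&: W)%VS D') ->
  ind_factored_pair W (traces W D) (color_blocks b W D).
Proof.
move=> famD H0D D' injD' surjD' indD indR.
have [injD dimD] := famD.
have D'D : D' `<=` D by exact: fset_sub.
have DD : D `\ H0 `<=` D by exact: fsubD1set.
have inD' H : (H \in D') = (H \in D) && (b H != b H0) by rewrite !inE.
have arrD := traces_arrangement famD.
have H0A : (H0 :&: W)%VS \in traces W D by apply/tracesP; exists H0.
pose B1 := traces W (fiber b D (b H0)).
have trD' : traces W D `\` B1 = traces W D'.
  apply/fsetP => Y; rewrite inE; apply/andP/tracesP.
    move=> [nY /tracesP[H HD eqY]]; exists H => //; move: nY.
    by rewrite eqY (mem_traces injD (fiber_sub _ _ _)) // in_fiber inD' HD.
  move=> [H]; rewrite inD' => /andP[HD nb] ->.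
  rewrite (mem_traces injD (fiber_sub _ _ _)) // in_fiber HD nb; split=> //.
  by apply/tracesP; exists H.
(* Hyperplanes of the color of [H0] add nothing to the restriction: by [surjD'] each cuts [H0] as
   some member of [D'] does. *)
have restrE : restriction (traces W D) (H0 :&: W)%VS = traces (H0 :&: W)%VS D'.
  apply/fsetP => Y; apply/(restrictionP _ arrD H0A)/tracesP.
    move=> [_ [/tracesP[H HD ->] neqH ->]]; rewrite capvCA_trace.
    have [HD'|] := boolP (H \in D'); first by exists H.
    rewrite inD' HD negbK => /eqP eqb; apply: surjD' => //.
    by apply: contra neqH => /eqP ->.
  move=> [H]; rewrite inD' => /andP[HD nb] ->.
  exists (H :&: W)%VS; split; first by apply/tracesP; exists H.
    by apply: contra nb => /eqP/injD ->.
  by rewrite capvCA_trace.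
have fiberD n : traces W (fiber b D n) `&` (traces W D `\ (H0 :&: W)%VS) =
                traces W (fiber b (D `\ H0) n).
  apply/fsetP => Y; rewrite !inE; apply/and3P/tracesP.
    move=> [/tracesP[H]]; rewrite in_fiber => /andP[HD bH] -> neq _.
    exists H => //; rewrite in_fiber !inE HD bH !andbT.
    by apply: contra neq => /eqP ->.
  move=> [H]; rewrite in_fiber !inE => /andP[/andP[neq HD] bH] ->; split.
  - by rewrite (mem_traces injD (fiber_sub _ _ _)) // in_fiber HD bH.
  - by apply: contra neq => /eqP/injD ->.
  - by apply/tracesP; exists H.
have delE : del_partition (color_blocks b W D) (traces W D) (H0 :&: W)%VS =
            color_blocks b W (D `\ H0).
  apply/fsetP => B; rewrite !inE; apply/andP/imfsetP => /=.
    move=> [nB /imfsetP[_ /= /imfsetP[/= H HD ->] eqB]]; move: nB eqB.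
    rewrite fiberD => nB eqB; have [Y] := fset0Pn _ nB.
    rewrite eqB => /tracesP[H']; rewrite in_fiber => /andP[H'D /eqP bH'] _.
    by exists H' => //; rewrite bH'.
  move=> [H HD ->]; split.
    apply/fset0Pn; exists (H :&: W)%VS; apply/tracesP; exists H => //.
    by rewrite in_fiber HD eqxx.
  apply/imfsetP; exists (traces W (fiber b D (b H))); last by rewrite fiberD.
  by apply/imfsetP; exists H => //; apply: (fsubsetP DD).
have restrpE : restr_partition (color_blocks b W D) B1 (H0 :&: W)%VS =
               color_blocks b (H0 :&: W)%VS D'.
  have fib H : H \in D' -> fiber b D (b H) = fiber b D' (b H).
    rewrite inD' => /andP[_ nb]; apply/fsetP => H'; rewrite !in_fiber inD' -andbA.
    by congr (_ && _); apply/eqP/andP => [->|[_ /eqP]].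
  apply/fsetP => B; apply/imfsetP/imfsetP => /=.
    move=> [C /fsetD1P[neq /imfsetP[/= H HD eqC]] ->].
    have HD' : H \in D'.
      by rewrite inD' HD; apply: contra neq => /eqP eqb; rewrite eqC eqb.
    by exists H; rewrite // eqC traces_trace fib.
  move=> [H HD' ->]; exists (traces W (fiber b D (b H))); last first.
    by rewrite traces_trace fib.
  move: HD'; rewrite inD' => /andP[HD nb].
  rewrite !inE; apply/andP; split; last by apply/imfsetP; exists H.
  apply/eqP => /fsetP/(_ (H :&: W)%VS).
  by rewrite !(mem_traces injD (fiber_sub _ _ _)) // !in_fiber HD eqxx (negPf nb).
apply: (@IndFactoredS _ _ _ _ _ B1 (H0 :&: W)%VS) => //.
- exact: color_blocks_partition.
- by apply/imfsetP; exists H0.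
- by rewrite (mem_traces injD (fiber_sub _ _ _)) // in_fiber H0D eqxx.
- rewrite /rho_bijective trD' traces_trace restrE; split=> //.
  move=> _ _ /tracesP[H HD' ->] /tracesP[H' H'D' ->].
  by rewrite !capvCA_trace => /injD' ->.
- rewrite delE; suff -> : traces W D `\ (H0 :&: W)%VS = traces W (D `\ H0) by [].
  apply/fsetP => Y; rewrite !inE; apply/andP/tracesP.
    move=> [neq /tracesP[H HD eqY]]; exists H => //; rewrite !inE HD andbT.
    by apply: contra neq => /eqP <-; rewrite eqY.
  move=> [H]; rewrite !inE => /andP[neq HD] ->; split.
    by apply: contra neq => /eqP/injD ->.
  by apply/tracesP; exists H.
- by rewrite restrE restrpE.
Qed.

(* The blocks of [b] come from a maximal chain of modular flats; the second
   clause is the modularity criterion of Bjorner, Edelman and Ziegler, and the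
   vector [v] of the third witnesses that the lower blocks form a flat. *)
Definition supersolvable b W D : Prop :=
  [/\ {in D, forall H, \dim W = (\dim (H :&: W)).+1},
      {in D &, forall H H', H != H' -> b H = b H' ->
        exists H'', [/\ H'' \in D, (b H'' < b H)%N & (H :&: H' :&: W <= H'')%VS]}
    & {in D, forall H, exists v, [/\ v \in W, v \notin H &
        {in D, forall H', (b H' < b H)%N -> v \in H'}]}].

(** Equal traces with different colors are separated by the witness vector of the higher one. With
    equal colors, the modular [H''] contains the common trace, hence has the same trace in a lower
    color, which is the first case. *)
Lemma supersolvable_family b W D : supersolvable b W D -> hyperplane_family W D.
Proof.
move=> [dimD modD flatD]; split=> //.
have neq_lt H H' : H \in D -> H' \in D -> (b H < b H')%N ->
    (H :&: W)%VS <> (H' :&: W)%VS.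
  move=> HD H'D lt_b eqW; have [v [vW nvH' vP]] := flatD H' H'D.
  have : v \in (H :&: W)%VS by rewrite memv_cap vW vP.
  by rewrite eqW memv_cap (negPf nvH').
move=> H H' HD H'D eqW; apply/eqP/idPn => neqH.
have [lt_b|lt_b|eqb] := ltngtP (b H) (b H').
- exact: neq_lt eqW.
- exact: neq_lt (esym eqW).
have [H'' [H''D lt_b le]] := modD H H' HD H'D neqH eqb.
apply: (neq_lt H'' H) => //; apply/esym/eqP; rewrite eqEdim.
rewrite -ltnS -!dimD // leqnn andbT subv_cap capvSr andbT.
by apply: subv_trans le; rewrite -capvA -eqW subv_cap capvSl /= subvv.
Qed.

(* Delete from the last block. The restriction to a hyperplane [H0] of the last
   block is the family of the lower blocks, traced on [H0]. *)
Theorem supersolvable_ind_factored b W D : supersolvable b W D ->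
  ind_factored_pair W (traces W D) (color_blocks b W D).
Proof.
have [n] := ubnP #|` D|; elim: n W D => // n IH W D le_n ssD.
have [->|/fset0Pn[H1 H1D]] := eqVneq D fset0.
  rewrite /traces /color_blocks !imfset0; exact: IndFactored0.
have [H0 H0D H0max] : exists2 H0, H0 \in D & {in D, forall H, (b H <= b H0)%N}.
  pose i1 : D := [` H1D].
  case: (@arg_maxnP _ i1 predT (fun i : D => b (val i)) isT) => i _ imax.
  exists (val i); first exact: valP.
  by move=> H HD; apply: (imax [` HD]).
have famD := supersolvable_family ssD; have [dimD modD flatD] := ssD.
have [injD _] := famD.
have [v [vW nvH0 vP]] := flatD H0 H0D.
set D' := [fset H in D | b H != b H0].
have inD' H : (H \in D') = (H \in D) && (b H < b H0)%N.
  rewrite !inE; case HD : (H \in D) => //=.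
  by rewrite ltn_neqAle H0max ?andbT.
have ssR : supersolvable b (H0 :&: W)%VS D'.
  split.
  - move=> H; rewrite inD' => /andP[HD lt_b].
    rewrite -capvCA_trace.
    apply: (cap_hyperplanes_codim1 (traces_arrangement famD)).
    + by apply/tracesP; exists H0.
    + by apply/tracesP; exists H.
    + by apply: contraTneq lt_b => /injD <- //; rewrite ltnn.
  - move=> H H'; rewrite !inD' => /andP[HD lt_b] /andP[H'D _] neq eqb.
    have [H'' [H''D lt_b' le]] := modD H H' HD H'D neq eqb.
    exists H''; split=> //; first by rewrite inD' H''D (ltn_trans lt_b').
    by apply: subv_trans le; rewrite capvS // capvSr.
  - move=> H; rewrite inD' => /andP[HD lt_b].
    have [u [uW nuH uP]] := flatD H HD.
    have [uH0|nuH0] := boolP (u \in H0).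
      exists u; split=> //; first by rewrite memv_cap uH0.
      by move=> H'; rewrite inD' => /andP[H'D _]; apply: uP.
    (* The witness [u] for [H] may lie outside [H0]. Since [v] is outside [H0] but in every
       hyperplane of lower color, a multiple of [v] moves [u] into [H0] without changing its
       position relative to those. *)
    have [k kP] : exists k, u - k *: v \in H0.
      have : u \in (H0 :&: W + <[v]>)%VS.
        suff -> : (H0 :&: W + <[v]>)%VS = W by [].
        apply/eqP; rewrite eqEdim subv_add capvSr -memvE vW /= (dimD H0) //.
        have v0 : v != 0 by apply: contraNneq nvH0 => ->; rewrite mem0v.
        rewrite dimv_disjoint_sum ?dim_vline ?v0 ?addn1 //.
        apply/eqP; rewrite -subv0; apply/subvP => w; rewrite memv_cap memv0.
        move=> /andP[/[swap] /vlineP[k ->]]; rewrite memv_cap => /andP[kH0 _].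
        have [->|k0] := eqVneq k 0; first by rewrite scale0r.
        by case/negP: nvH0; rewrite -[v](scalerK k0) memvZ.
      case/memv_addP => w wH0 [_ /vlineP[k ->] ->]; exists k; rewrite addrK.
      by move: wH0; rewrite memv_cap => /andP[].
    have vH : v \in H by apply: vP.
    exists (u - k *: v); split.
    + by rewrite memv_cap kP memvB ?memvZ.
    + apply: contra nuH => uvH; rewrite -[u](subrK (k *: v)).
      by rewrite memvD ?memvZ.
    + move=> H'; rewrite inD' => /andP[H'D lt_b'] lt_b2.
      by rewrite memvB ?memvZ ?vP ?uP.
apply: (ind_factored_step famD H0D).
- by have [] := supersolvable_family ssR.
(* The modular [H''] contains the trace of [H] on [H0], and both traces have codimension 1 in
   [H0 :&: W], so they agree. *)
- move=> H HD neqH eqb; have [H'' [H''D lt_b le]] := modD H H0 HD H0D neqH eqb.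
  have H''D' : H'' \in D' by rewrite inD' H''D -eqb.
  exists H'' => //; apply/eqP; rewrite eqEdim subv_cap capvSr andbT.
  rewrite capvA le /= -ltnS; have [dimR _ _] := ssR; rewrite -dimR // -capvA.
  rewrite -capvCA_trace.
  rewrite -(cap_hyperplanes_codim1 (traces_arrangement famD)) //.
  + by apply/tracesP; exists H0.
  + by apply/tracesP; exists H.
  + by apply: contra neqH => /eqP/injD ->.
- apply: IH; first by move: le_n; rewrite (cardfsD1 H0) H0D.
  split.
  + by move=> H /fsetD1P[_ HD]; apply: dimD.
  + move=> H H' /fsetD1P[_ HD] /fsetD1P[_ H'D] neq eqb.
    have [H'' [H''D lt_b le]] := modD H H' HD H'D neq eqb.
    exists H''; split=> //; rewrite !inE H''D andbT.
    by apply: contraTneq lt_b => ->; rewrite -leqNgt H0max.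
  + move=> H /fsetD1P[_ HD]; have [u [uW nuH uP]] := flatD H HD.
    by exists u; split=> // H' /fsetD1P[_ H'D]; apply: uP.
- apply: IH => //; move: le_n; rewrite (cardfsD1 H0) H0D add1n ltnS.
  apply: leq_trans; rewrite ltnS; apply: fsubset_leq_card.
  apply/fsubsetP => H; rewrite inD' !inE => /andP[-> lt_b]; rewrite andbT.
  by apply: contraTneq lt_b => ->; rewrite ltnn.
Qed.

Lemma traces_fullv D : traces fullv D = D.
Proof.
apply/fsetP => Y; apply/tracesP/idP => [[H HD ->]|YD]; first by rewrite capvf.
by exists Y; rewrite ?capvf.
Qed.

End ColoredFamilies.

(** * Inductively factored cases: [k >= l - 2] *)

Section IntermediateArrangements.
Local Open Scope fset_scope.
Local Open Scope ring_scope.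
Local Opaque coord_hyp diff_hyp.
Variables (K : fieldType) (r : nat) (zeta : K).
Hypothesis zeta_prim : r.-primitive_root zeta.

Lemma root1_neq0 (c : K) : c ^+ r = 1 -> c != 0.
Proof.
move=> c1; apply/eqP => c0; move: c1; rewrite c0 expr0n.
rewrite (gtn_eqF (prim_order_gt0 zeta_prim)) => /eqP.
by rewrite eq_sym oner_eq0.
Qed.

Lemma root1V (c : K) : c ^+ r = 1 -> c^-1 ^+ r = 1.
Proof. by rewrite exprVn => ->; rewrite invr1. Qed.

Lemma root1M (c d : K) : c ^+ r = 1 -> d ^+ r = 1 -> (c * d) ^+ r = 1.
Proof. by rewrite exprMn => -> ->; rewrite mulr1. Qed.

Lemma root1_zeta : zeta ^+ r = 1.
Proof. exact: prim_expr_order. Qed.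

Lemma zeta_neq1 : (2 <= r)%N -> zeta != 1.
Proof.
move=> r2; apply/eqP => z1; have := prim_order_dvd zeta_prim 1.
by rewrite expr1 z1 eqxx dvdn1 (gtn_eqF r2).
Qed.

Lemma diff_hyp_sym l (c : K) (i j : 'I_l) : c != 0 ->
  diff_hyp c i j = diff_hyp c^-1 j i.
Proof.
move=> c0; apply/vspaceP => x; rewrite !diff_hypE !subr_eq0.
apply/eqP/eqP => ->; by rewrite ?mulKf ?mulVKf.
Qed.

Lemma coord_hypP l (i : 'I_l) (x : 'rV[K]_l) :
  reflect (x 0 i = 0) (x \in coord_hyp K i).
Proof. by rewrite coord_hypE; apply: eqP. Qed.

Lemma diff_hypP l (c : K) (i j : 'I_l) (x : 'rV[K]_l) :
  reflect (x 0 i = c * x 0 j) (x \in diff_hyp c i j).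
Proof. by rewrite diff_hypE subr_eq0; apply: eqP. Qed.

Lemma capv_subP (V : vectType K) (U1 U2 U : {vspace V}) :
  (forall x, x \in U1 -> x \in U2 -> x \in U) -> (U1 :&: U2 <= U)%VS.
Proof. by move=> sub; apply/subvP => x /memv_capP[]; apply: sub. Qed.

Lemma AklP l k (H : {vspace 'rV[K]_l}) :
  reflect ((exists2 i : 'I_l, (i < k)%N & H = coord_hyp K i) \/
           (exists c (i j : 'I_l), [/\ c ^+ r = 1, (i < j)%N & H = diff_hyp c i j]))
    (H \in @Akl K l r k zeta).
Proof.
rewrite inE; apply: (iffP orP) => [[/imfsetP[/= i ik ->]|]|[[i ik ->]|]].
- by left; exists i.
- move=> /imfsetP[/= [[i j] t] /= ltij ->]; right.
  by exists (zeta ^+ t), i, j; split; rewrite // exprAC root1_zeta expr1n.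
- by left; apply/imfsetP; exists i.
- move=> [c [i [j [/(prim_rootP zeta_prim)[t ->] ltij ->]]]]; right.
  by apply/imfsetP; exists (i, j, t).
Qed.

Lemma coord_Akl l k (i : 'I_l) : (i < k)%N -> coord_hyp K i \in @Akl K l r k zeta.
Proof. by move=> ik; apply/AklP; left; exists i. Qed.

Lemma diff_Akl l k c (i j : 'I_l) : c ^+ r = 1 -> i != j ->
  diff_hyp c i j \in @Akl K l r k zeta.
Proof.
move=> c1; rewrite -val_eqE neq_ltn => /orP[] ltij; apply/AklP; right.
  by exists c, i, j.
exists c^-1, j, i; split=> //; first exact: root1V.
exact/diff_hyp_sym/root1_neq0.
Qed.

Lemma delta_coord_hyp l (m i : 'I_l) :
  (delta_mx 0 m \in coord_hyp K i) = (m != i).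
Proof.
rewrite coord_hypE mxE eqxx /= [i == m]eq_sym.
by case: (eqVneq m i) => _; rewrite ?eqxx ?oner_eq0.
Qed.

Lemma delta_diff_hyp l (c : K) (m i j : 'I_l) : c != 0 -> i != j ->
  (delta_mx 0 m \in diff_hyp c i j) = (m != i) && (m != j).
Proof.
move=> c0 neq; rewrite diff_hypE !mxE eqxx /= ![_ == m]eq_sym.
have [->|] := eqVneq m i; first by rewrite (negPf neq) mulr0 subr0 oner_eq0.
have [->|] := eqVneq m j; first by rewrite mulr1 sub0r oppr_eq0 (negPf c0).
by rewrite mulr0 subrr eqxx.
Qed.

(** A basis vector lies outside a hyperplane exactly when its coordinate occurs in the equation, so
    this reads the last coordinate off the subspace without choosing an equation. *)
Definition top l (H : {vspace 'rV[K]_l}) : nat :=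
  \max_(i < l | delta_mx 0 i \notin H) i.

Lemma top_coord_hyp l (j : 'I_l) : top (coord_hyp K j) = j.
Proof.
rewrite /top (big_pred1 j) // => i.
by rewrite delta_coord_hyp negbK.
Qed.

Lemma top_diff_hyp l (c : K) (i j : 'I_l) : c != 0 -> (i < j)%N ->
  top (diff_hyp c i j) = j.
Proof.
move=> c0 ltij; have neq : i != j by rewrite -val_eqE ltn_eqF.
apply/eqP; rewrite eqn_leq; apply/andP; split.
  apply/bigmax_leqP => m; rewrite delta_diff_hyp // negb_and !negbK.
  by case/orP => /eqP -> //; apply: ltnW.
apply: (leq_bigmax_cond (F := fun i : 'I_l => nat_of_ord i)).
by rewrite delta_diff_hyp // eqxx andbF.
Qed.

Lemma top_lt_mem l (H : {vspace 'rV[K]_l}) (m : 'I_l) :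
  (top H < m)%N -> delta_mx 0 m \in H.
Proof.
rewrite ltnNge; apply: contraNT => nH.
exact: (leq_bigmax_cond (F := fun i : 'I_l => nat_of_ord i)).
Qed.

Lemma Akl_cases l k (H : {vspace 'rV[K]_l}) : H \in @Akl K l r k zeta ->
  (exists i : 'I_l, [/\ (i < k)%N, H = coord_hyp K i & top H = i]) \/
  (exists c (i j : 'I_l),
     [/\ c ^+ r = 1, (i < j)%N, H = diff_hyp c i j & top H = j]).
Proof.
case/AklP => [[i ik ->]|[c [i [j [c1 ltij ->]]]]].
  by left; exists i; split=> //; apply: top_coord_hyp.
right; exists c, i, j; split=> //; apply: top_diff_hyp => //.
exact: root1_neq0.
Qed.

(** Eliminating x_j gives x_i = (c / c') x_i' when i and i' differ. For i = i' and c <> c' it gives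
    x_i = 0 instead, which is where [i < k] is required. *)
Lemma diff_modular l k c c' (i i' j : 'I_l) :
  c ^+ r = 1 -> c' ^+ r = 1 -> (i = i' -> i < k)%N ->
  diff_hyp c i j != diff_hyp c' i' j ->
  exists H, [/\ H \in @Akl K l r k zeta, top H = maxn i i' &
    (diff_hyp c i j :&: diff_hyp c' i' j <= H)%VS].
Proof.
move=> c1 c'1; have c0 := root1_neq0 c1; have c'0 := root1_neq0 c'1.
have [<-|neqi _ _] := eqVneq i i'.
  move=> /(_ erefl) ik neq.
  exists (coord_hyp K i); split; [exact: coord_Akl | by rewrite top_coord_hyp maxnn |].
  apply: capv_subP => x /diff_hypP xi /diff_hypP; rewrite xi => eqx.
  apply/coord_hypP; rewrite xi.
  have [xj0|xj0] := eqVneq (x 0 j) 0; first by rewrite xj0 mulr0.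
  by case/eqP: neq; rewrite (mulIf xj0 eqx).
have sub : (diff_hyp c i j :&: diff_hyp c' i' j <= diff_hyp (c / c') i i')%VS.
  apply: capv_subP => x /diff_hypP xi /diff_hypP xi'; apply/diff_hypP.
  by rewrite xi xi' mulrA divfK.
have cc1 : (c / c') ^+ r = 1 by apply: root1M => //; apply: root1V.
exists (diff_hyp (c / c') i i'); split=> //; first exact: diff_Akl.
move: neqi; rewrite -val_eqE neq_ltn => /orP[] lt.
  by rewrite top_diff_hyp ?root1_neq0 // (maxn_idPr (ltnW lt)).
rewrite diff_hyp_sym ?root1_neq0 // top_diff_hyp ?invr_neq0 ?root1_neq0 //.
by rewrite (maxn_idPl (ltnW lt)).
Qed.

(** Stated for a subfamily [D] and a coloring that merely agrees with [top] on it, so as to cover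
    both the whole arrangement for [k >= l - 1] and what is left for [k = l - 2] after the
    deletions. The last hypothesis supplies x_i = 0 for [diff_modular]. *)
Lemma supersolvable_top n k (D : {fset {vspace 'rV[K]_n.+1}})
    (b : {vspace 'rV[K]_n.+1} -> nat) :
  D `<=` @Akl K n.+1 r k zeta ->
  {in D, b =1 @top n.+1} ->
  (forall H, H \in @Akl K n.+1 r k zeta -> (top H < n)%N -> H \in D /\ b H = top H) ->
  (forall c c' (i j : 'I_n.+1), c != c' -> c ^+ r = 1 -> c' ^+ r = 1 ->
     (i < j)%N -> diff_hyp c i j \in D -> diff_hyp c' i j \in D -> (i < k)%N) ->
  supersolvable b fullv D.
Proof.
move=> /fsubsetP DA bD lowD diffD; split.
- by move=> H /DA HA; rewrite capvf; have [] := Akl_arrangement HA.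
- move=> H H' HD H'D neq eqb.
  have modular (H1 : {vspace 'rV[K]_n.+1}) : H1 \in @Akl K n.+1 r k zeta ->
      (top H1 < top H)%N -> (top H <= n)%N ->
      (H :&: H' <= H1)%VS ->
      exists H'', [/\ H'' \in D, (b H'' < b H)%N & (H :&: H' :&: fullv <= H'')%VS].
    move=> H1A ltH1 leH le; have [H1D bH1] := lowD H1 H1A (leq_trans ltH1 leH).
    by exists H1; split; rewrite // ?bH1 ?bD // capvf.
  have {}eqb : top H = top H' by rewrite -!bD.
  have [[i [ik eH tH]]|[c [i [j [c1 ltij eH tH]]]]] := Akl_cases (DA H HD);
    have [[i' [i'k eH' tH']]|[c' [i' [j' [c'1 lti'j' eH' tH']]]]] :=
      Akl_cases (DA H' H'D);
    have {}eqb := val_inj (etrans (esym tH) (etrans eqb tH')).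
  + by case/eqP: neq; rewrite eH eH' eqb.
  + apply: (modular (coord_hyp K i')).
    * by apply: coord_Akl; apply: ltn_trans ik; rewrite eqb.
    * by rewrite top_coord_hyp tH eqb.
    * by rewrite tH -ltnS.
    rewrite eH eH' -eqb.
    apply: capv_subP => x /coord_hypP xi /diff_hypP xi'; apply/coord_hypP.
    by rewrite xi' xi mulr0.
  + apply: (modular (coord_hyp K i)).
    * by apply: coord_Akl; apply: ltn_trans i'k; rewrite -eqb.
    * by rewrite top_coord_hyp tH.
    * by rewrite tH -ltnS.
    rewrite eH eH' -eqb.
    apply: capv_subP => x /diff_hypP xi /coord_hypP xi'; apply/coord_hypP.
    by rewrite xi xi' mulr0.
  + subst j'.
    have {}neq : diff_hyp c i j != diff_hyp c' i' j by rewrite -eH -eH'.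
    have ik : i = i' -> (i < k)%N.
      move=> eqi; subst i'; apply: (diffD c c' i j) => //.
      - by apply: contra neq => /eqP ->.
      - by rewrite -eH.
      - by rewrite -eH'.
    have [H'' [H''A topH'' le]] := diff_modular c1 c'1 ik neq.
    apply: (modular H'') => //; last by rewrite eH eH'.
      by rewrite topH'' tH gtn_max ltij.
    by rewrite tH -ltnS.
- move=> H HD.
  have [j [topH njH]] : exists j : 'I_n.+1, top H = j /\ delta_mx 0 j \notin H.
    have [[i [ik eH tH]]|[c [i [j [c1 ltij eH tH]]]]] := Akl_cases (DA H HD).
      by exists i; split=> //; rewrite eH delta_coord_hyp eqxx.
    exists j; split=> //; rewrite eH delta_diff_hyp ?root1_neq0 //.
      by rewrite eqxx andbF.
    by rewrite -val_eqE /= ltn_eqF.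
  exists (delta_mx 0 j); split=> //; first exact: memvf.
  by move=> H' H'D; rewrite !bD // topH => /top_lt_mem.
Qed.

Lemma Akl_ind_factored_ge_pred n k : (n <= k)%N ->
  inductively_factored fullv (@Akl K n.+1 r k zeta).
Proof.
move=> le_nk; exists (color_blocks (@top n.+1) fullv (@Akl K n.+1 r k zeta)).
rewrite -[X in ind_factored_pair _ X]traces_fullv.
apply: supersolvable_ind_factored; apply: (@supersolvable_top n k) => //.
move=> c c' i j _ _ _ ltij _ _; apply: leq_trans ltij (leq_trans _ le_nk).
by rewrite -ltnS.
Qed.

Lemma in_fset_filter (T : choiceType) (E : {fset T}) (P : pred T) x :
  (x \in [fset y in E | P y]) = (x \in E) && P x.
Proof. by rewrite !inE. Qed.

Definition penult n : 'I_n.+2 := widen_ord (leqnSn n.+1) ord_max.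

(** The first two tests say that both last coordinates occur; the third excludes c = 1, the only
    case where the sum of the two basis vectors solves x_(l-1) = c x_l. *)
Definition mixed n (H : {vspace 'rV[K]_n.+2}) : bool :=
  [&& delta_mx 0 (penult n) \notin H, delta_mx 0 ord_max \notin H &
      delta_mx 0 (penult n) + delta_mx 0 ord_max \notin H].

(* The hyperplanes [x_(l-1) = c x_l] with [c <> 1] are moved to the block of
   index [l - 1]; only [x_(l-1) = x_l] stays in the last block. *)
Definition recolor n (H : {vspace 'rV[K]_n.+2}) : nat :=
  if mixed H then n else top H.

Lemma penult_neq_max n : penult n != ord_max.
Proof. by rewrite -val_eqE /= ltn_eqF. Qed.

Lemma mixed_diff_hyp n c : c ^+ r = 1 -> c != 1 ->
  mixed (diff_hyp c (penult n) ord_max).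
Proof.
move=> c1 cn1; have c0 := root1_neq0 c1; have neq := penult_neq_max n.
apply/and3P; split.
- by rewrite delta_diff_hyp // eqxx.
- by rewrite delta_diff_hyp // eqxx andbF.
apply: contra cn1 => /diff_hypP; rewrite !mxE !eqxx /= [ord_max == _]eq_sym !(negPf neq).
by rewrite add0r addr0 mulr1 => <-.
Qed.

Lemma mixedP n (H : {vspace 'rV[K]_n.+2}) : H \in @Akl K n.+2 r n zeta -> mixed H ->
  exists c, [/\ c ^+ r = 1, c != 1 & H = diff_hyp c (penult n) ord_max].
Proof.
move=> /Akl_cases[[i [ik eH tH]]|[c [i [j [c1 ltij eH tH]]]]] /and3P[np nq npq].
  case/negP: np; rewrite eH delta_coord_hyp -val_eqE /=.
  by rewrite gtn_eqF.
have neqij : i != j by rewrite -val_eqE /= ltn_eqF.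
have c0 := root1_neq0 c1.
move: np nq; rewrite eH !delta_diff_hyp // !negb_and !negbK -!val_eqE /= => np nq.
have ltj := ltn_ord j.
have /eqP ei : i == penult n by rewrite -val_eqE /=; lia.
have /eqP ej : j == ord_max by rewrite -val_eqE /=; lia.
subst i j; exists c; split=> //; apply: contra npq => /eqP c1'.
rewrite eH; apply/diff_hypP; rewrite c1' !mxE !eqxx /= [ord_max == _]eq_sym !(negPf neqij).
by rewrite add0r addr0 mulr1.
Qed.

Lemma top_lt_mixed n (H : {vspace 'rV[K]_n.+2}) : (top H < n.+1)%N -> ~~ mixed H.
Proof.
move=> ltH; rewrite /mixed !negb_and !negbK; apply/orP; right; apply/orP; left.
exact: top_lt_mem.
Qed.

(** * Restriction to E_(l-1,l)(a) with a <> 1 *)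

Section RestrictionToMixed.
Variables (n : nat) (D : {fset {vspace 'rV[K]_n.+2}}) (a : K).
Let A := @Akl K n.+2 r n zeta.
Let H0 := diff_hyp a (penult n) ord_max.
Hypotheses (DA : D `<=` A) (D_unmixed : {in A, forall H, ~~ mixed H -> H \in D}).
Hypotheses (a1 : a ^+ r = 1) (a_neq1 : a != 1).

Let D' := [fset H in D | recolor H != n].

(** Dropping color [n] removes the mixed hyperplanes together with those ending at x_(l-1). Hence
    x_(l-1) survives only in E_(l-1,l)(1). *)
Lemma unmixed_cases H : H \in D' ->
  [/\ ~~ mixed H, recolor H = top H & H \in A] /\
  [\/ exists i : 'I_n.+2, [/\ (i < n)%N, H = coord_hyp K i & top H = i],
      exists c (i j : 'I_n.+2),
        [/\ c ^+ r = 1, (i < j)%N, (i < n)%N /\ j != n :> nat,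
            H = diff_hyp c i j & top H = j]
    | H = diff_hyp 1 (penult n) ord_max /\ top H = n.+1].
Proof.
rewrite in_fset_filter => /andP[HD cH]; have HA := fsubsetP DA H HD.
have nmix : ~~ mixed H by apply: contra cH; rewrite /recolor => ->.
have cHt : recolor H = top H by rewrite /recolor (negPf nmix).
split=> //.
move: cH; rewrite cHt => cH.
have [[i [ik eH tH]]|[c [i [j [c1 ltij eH tH]]]]] := Akl_cases HA.
  by constructor 1; exists i.
have ltj := ltn_ord j.
have [lt_in|le_ni] := ltnP i n.
  by constructor 2; exists c, i, j; split=> //; split=> //; rewrite -tH.
have /eqP ei : i == penult n by rewrite -val_eqE /=; lia.
have /eqP ej : j == ord_max by rewrite -val_eqE /=; lia.
subst i j; constructor 3; split=> //.
have [ec|cn1] := eqVneq c 1; first by rewrite eH ec.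
by case/negP: nmix; rewrite eH; apply: mixed_diff_hyp.
Qed.

Lemma low_mem H : H \in A -> (top H < n)%N -> H \in D' /\ recolor H = top H.
Proof.
move=> HA ltH; have nmix : ~~ mixed H by apply: top_lt_mixed; apply: ltnW.
have cHt : recolor H = top H by rewrite /recolor (negPf nmix).
by split=> //; rewrite in_fset_filter D_unmixed //= cHt ltn_eqF.
Qed.

Lemma H0_mem : H0 \in A.
Proof. by apply: diff_Akl => //; apply: penult_neq_max. Qed.

(** Take x_1, ..., x_(l-2), x_l as coordinates on [H0]. Since a <> 1, E_(l-1,l)(1) becomes x_l = 0,
    and [D'] traces the full monomial arrangement, where every coordinate hyperplane needed for
    modularity is present. *)
Lemma supersolvable_restriction : supersolvable (@recolor n) (H0 :&: fullv)%VS D'.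
Proof.
rewrite capvf; split.
- move=> H /unmixed_cases[[nmix _ HA] _].
  apply: (cap_hyperplanes_codim1 (@Akl_arrangement K n.+2 r n zeta)) => //.
    exact: H0_mem.
  by apply: contraNneq nmix => <-; apply: mixed_diff_hyp.
- move=> H H' /unmixed_cases[[_ cH HA] caseH] /unmixed_cases[[_ cH' H'A] caseH'].
  move=> neq; rewrite cH cH' => eqb.
  have modular H1 : H1 \in A -> (top H1 < n)%N -> (top H1 < top H)%N ->
      (forall x, x \in H -> x \in H' -> x \in H0 -> x \in H1) ->
      exists H'', [/\ H'' \in D', (recolor H'' < top H)%N &
        (H :&: H' :&: H0 <= H'')%VS].
    move=> H1A ltn ltH sub; have [H1D' c1] := low_mem H1A ltn.
    exists H1; split=> //; first by rewrite c1.
    by apply: capv_subP => x /memv_capP[]; apply: sub.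
  (* On [H0], x_(l-1) = x_l and x_(l-1) = a x_l force x_l = 0, and then x_i = c x_l = 0: this is the
     modular partner for the new pair type. *)
  have two (i : 'I_n.+2) c H1 H2 : (i < n)%N -> H1 = diff_hyp c i ord_max ->
      H2 = diff_hyp 1 (penult n) ord_max ->
      forall x, x \in H1 -> x \in H2 -> x \in H0 -> x \in coord_hyp K i.
    move=> lti -> -> x /diff_hypP xi /diff_hypP; rewrite mul1r => xp /diff_hypP.
    rewrite xp -{1}[x 0 ord_max]mul1r => /eqP; rewrite -subr_eq0 -mulrBl mulf_eq0.
    rewrite subr_eq0 eq_sym (negPf a_neq1) /= => /eqP xq.
    by apply/coord_hypP; rewrite xi xq mulr0.
  have coord_top (i : 'I_n.+2) := top_coord_hyp i.
  case: caseH => [[i [ik eH tH]]|[c [i [j [c1 ltij [lti nj] eH tH]]]]|[eH tH]];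
  case: caseH' => [[i' [i'k eH' tH']]
                  |[c' [i' [j' [c'1 lti'j' [lti' nj'] eH' tH']]]]|[eH' tH']];
    move: (etrans (esym tH) (etrans eqb tH')) => {}eqb.
  + by case/eqP: neq; rewrite eH eH'; congr coord_hyp; apply: val_inj.
  + move: eqb => /val_inj eqb.
    apply: (modular (coord_hyp K i')).
    * exact: coord_Akl.
    * by rewrite coord_top.
    * by rewrite coord_top tH eqb.
    move=> x; rewrite eH eH' eqb => /coord_hypP xi /diff_hypP xi' _.
    by apply/coord_hypP; rewrite xi' xi mulr0.
  + by move: ik; rewrite eqb; lia.
  + move: eqb => /val_inj eqb.
    apply: (modular (coord_hyp K i)).
    * exact: coord_Akl.
    * by rewrite coord_top.
    * by rewrite coord_top tH.
    move=> x; rewrite eH eH' -eqb => /diff_hypP xi /coord_hypP xi' _.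
    by apply/coord_hypP; rewrite xi xi' mulr0.
  + move: eqb => /val_inj eqb; subst j'.
    have {}neq : diff_hyp c i j != diff_hyp c' i' j by rewrite -eH -eH'.
    have [H'' [H''A topH'' /subvP le]] := diff_modular c1 c'1 (fun _ => lti) neq.
    apply: (modular H'') => //.
    * by rewrite topH'' gtn_max lti.
    * by rewrite topH'' tH gtn_max ltij.
    by move=> x; rewrite eH eH' => xH xH' _; apply: le; apply/memv_capP.
  + have ej : j = ord_max by apply: val_inj.
    apply: (modular (coord_hyp K i)).
    * exact: coord_Akl.
    * by rewrite coord_top.
    * by rewrite coord_top tH.
    by apply: two => //; rewrite eH ej.
  + by move: i'k; rewrite -eqb; lia.
  + have ej' : j' = ord_max by apply: val_inj.
    apply: (modular (coord_hyp K i')).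
    * exact: coord_Akl.
    * by rewrite coord_top.
    * by rewrite coord_top tH; lia.
    move=> x xH xH'; apply: two xH' xH => //; rewrite eH' ej' //.
  + by case/eqP: neq; rewrite eH eH'.
- move=> H /unmixed_cases[[_ cH HA] caseH].
  have low (j : 'I_n.+2) : (j < n)%N -> top H = j -> delta_mx 0 j \notin H ->
      exists v, [/\ v \in H0, v \notin H &
        {in D', forall H', (recolor H' < recolor H)%N -> v \in H'}].
    move=> ltj tH njH; exists (delta_mx 0 j); split=> //.
      rewrite delta_diff_hyp ?penult_neq_max ?root1_neq0 //.
      by rewrite -!val_eqE /= !ltn_eqF // ltnW.
    move=> H' /unmixed_cases[[_ cH' _] _]; rewrite cH cH' tH.
    exact: top_lt_mem.
  (* The last basis vector is not in [H0]; this is its replacement, the vector of [H0] with x_l = 1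
     and the first l - 2 coordinates zero. *)
  pose v : 'rV[K]_n.+2 := a *: delta_mx 0 (penult n) + delta_mx 0 ord_max.
  have vp : v 0 (penult n) = a.
    by rewrite !mxE !eqxx (negPf (penult_neq_max n)) mulr1 addr0.
  have vq : v 0 ord_max = 1.
    by rewrite !mxE !eqxx [_ == penult n]eq_sym (negPf (penult_neq_max n)) mulr0 add0r.
  have vi (i : 'I_n.+2) : (i < n)%N -> v 0 i = 0.
    move=> lti; rewrite !mxE !eqxx -!val_eqE /= !ltn_eqF ?mulr0 ?addr0 //.
    exact: ltnW.
  have high : top H = n.+1 -> v \notin H ->
      exists v, [/\ v \in H0, v \notin H &
        {in D', forall H', (recolor H' < recolor H)%N -> v \in H'}].
    move=> tH nvH; exists v; split=> //; first by apply/diff_hypP; rewrite vp vq mulr1.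
    move=> H' /unmixed_cases[[_ cH' _] caseH']; rewrite cH cH' tH.
    case: caseH' => [[i [ik eH' tH']]|[c [i [j [c1 ltij [lti nj] eH' tH']]]]|[eH' ->]] ltt.
    + by rewrite eH'; apply/coord_hypP; apply: vi.
    + rewrite eH'; apply/diff_hypP; rewrite vi // vi ?mulr0 //.
      by move: ltt nj; rewrite tH'; lia.
    + by rewrite ltnn in ltt.
  case: caseH => [[i [ik eH tH]]|[c [i [j [c1 ltij [lti nj] eH tH]]]]|[eH tH]].
  + by apply: (low i) => //; rewrite eH delta_coord_hyp eqxx.
  + have [ltj|lej] := ltnP j n.
      apply: (low j) => //; rewrite eH delta_diff_hyp ?eqxx ?andbF ?root1_neq0 //.
      by rewrite -val_eqE /= ltn_eqF.
    have /eqP ej : j == ord_max.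
      by have := ltn_ord j; move: nj lej; rewrite -val_eqE /=; lia.
    apply: high; first by rewrite tH ej.
    rewrite eH ej; apply/diff_hypP; rewrite vi // vq mulr1 => /esym/eqP.
    by apply/negP; apply: root1_neq0.
  + apply: high => //; rewrite eH; apply/diff_hypP; rewrite vp vq mulr1 => /eqP.
    exact/negP.
Qed.

(** Color [n] has two kinds of members. Another mixed hyperplane meets [H0] in x_(l-1) = x_l = 0, as
    E_(l-1,l)(1) does; E_(i,l-1)(c) meets it as E_(i,l)(c a) does. *)
Lemma restriction_to_mixed_surj H : H \in D -> H != H0 -> recolor H = n ->
  exists2 H', H' \in D' & (H :&: (H0 :&: fullv) = H' :&: (H0 :&: fullv))%VS.
Proof.
move=> HD neq cH; have HA := fsubsetP DA H HD; rewrite capvf.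
have eq_cap (H1 : {vspace 'rV[K]_n.+2}) :
    (forall x, x \in H0 -> (x \in H) = (x \in H1)) ->
    (H :&: H0 = H1 :&: H0)%VS.
  move=> eqH; apply/vspaceP => x; apply/memv_capP/memv_capP => -[xH xH0].
    by rewrite -eqH.
  by rewrite eqH.
have last_mem (H1 : {vspace 'rV[K]_n.+2}) :
    H1 \in A -> ~~ mixed H1 -> top H1 = n.+1 -> H1 \in D'.
  move=> H1A nmix tH1.
  rewrite in_fset_filter D_unmixed //= /recolor (negPf nmix) tH1.
  by rewrite gtn_eqF.
have neqpq := penult_neq_max n.
have a0 := root1_neq0 a1.
have [mixH|nmix] := boolP (mixed H).
  have [c [c1 cn1 eH]] := mixedP HA mixH.
  exists (diff_hyp 1 (penult n) ord_max).
    apply: last_mem; first by apply: diff_Akl; rewrite ?expr1n.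
      apply/negP => /and3P[_ _ /negP]; apply; apply/diff_hypP.
      by rewrite !mxE !eqxx [ord_max == _]eq_sym !(negPf neqpq) add0r addr0 mulr1.
    by rewrite top_diff_hyp ?oner_eq0.
  apply: eq_cap => x /diff_hypP xp; rewrite eH.
  have zero (d e : K) : d != e -> d * x 0 ord_max = e * x 0 ord_max -> x 0 ord_max = 0.
    move=> de /eqP; rewrite -subr_eq0 -mulrBl mulf_eq0 subr_eq0 (negPf de) /=.
    by move/eqP.
  have neqac : a != c by apply: contra neq => /eqP ac; rewrite eH /H0 ac.
  apply/diff_hypP/diff_hypP; rewrite xp => eqx.
    by rewrite (zero a c neqac eqx) !mulr0.
  by rewrite (zero a 1 a_neq1 eqx) !mulr0.
have tH : top H = n by move: cH; rewrite /recolor (negPf nmix).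
have [[i [ik eH tH']]|[c [i [j [c1 ltij eH tH']]]]] := Akl_cases HA.
  by move: ik; rewrite -tH' tH ltnn.
have ej : j = penult n by apply: val_inj; rewrite /= -tH' tH.
subst j; rewrite /= in ltij.
exists (diff_hyp (c * a) i ord_max).
  have neqi : i != ord_max by rewrite -val_eqE /= ltn_eqF // ltnW.
  have ca0 : c * a != 0 by apply: root1_neq0; apply: root1M.
  apply: last_mem.
  - by apply: diff_Akl => //; apply: root1M.
  - apply/negP => /and3P[/negP[]]; rewrite delta_diff_hyp // neqpq andbT.
    by rewrite -val_eqE /= gtn_eqF.
  - by rewrite top_diff_hyp // ltnW.
apply: eq_cap => x /diff_hypP xp; rewrite eH.
by apply/diff_hypP/diff_hypP => ->; rewrite xp mulrA.
Qed.

End RestrictionToMixed.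

Lemma Akl_ind_factored_eq_pred2 n : inductively_factored fullv (@Akl K n.+2 r n zeta).
Proof.
set A := Akl _ _ _ _.
have arrA : is_arrangement fullv A := @Akl_arrangement K n.+2 r n zeta.
pose mix := [fset H in A | mixed H].
(* Induction on the number of mixed hyperplanes left. [D] keeps all unmixed ones, since the
   restriction to a mixed hyperplane needs them to absorb the members of color [n]. *)
have mainD m (D : {fset {vspace 'rV[K]_n.+2}}) : #|` D `&` mix| = m ->
    D `<=` A -> {in A, forall H, ~~ mixed H -> H \in D} ->
    ind_factored_pair fullv (traces fullv D) (color_blocks (@recolor n) fullv D).
  elim: m D => [|m IH] D cardD DA D_unmixed.
    have nmixD H : H \in D -> ~~ mixed H.
      move=> HD; apply/negP => mixH; move: (cardfs0_eq cardD) => /fsetP/(_ H).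
      by rewrite in_fsetI in_fset_filter HD mixH (fsubsetP DA) ?in_fset0.
    apply: supersolvable_ind_factored; apply: (@supersolvable_top n.+1 n) => //.
    - by move=> H /nmixD nm; rewrite /recolor (negPf nm).
    - move=> H HA /top_lt_mixed nm; split; first exact: D_unmixed.
      by rewrite /recolor (negPf nm).
    (* Only the pair (l-1, l) could call for the missing x_(l-1) = 0, and of it just c = 1 is
       left. *)
    move=> c c' i j ncc' c1 c'1 ltij cD c'D; rewrite ltnNge; apply/negP => le_ni.
    have /eqP ei : i == penult n.
      by have := ltn_ord j; rewrite -val_eqE /=; move: ltij le_ni; lia.
    have /eqP ej : j == ord_max.
      by have := ltn_ord j; rewrite -val_eqE /=; move: ltij le_ni; lia.
    subst i j; have unm d : d ^+ r = 1 -> diff_hyp d (penult n) ord_max \in D -> d = 1.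
      move=> d1 /nmixD; apply: contraNeq; exact: mixed_diff_hyp.
    by case/eqP: ncc'; exact: etrans (unm c c1 cD) (esym (unm c' c'1 c'D)).
  have [H0 H0Dm] : exists H0, H0 \in D `&` mix.
    by apply/fset0Pn; rewrite -cardfs_gt0 cardD.
  move: (H0Dm); rewrite in_fsetI in_fset_filter => /and3P[H0D H0A mixH0].
  have [a [a1 an1 eH0]] := mixedP H0A mixH0.
  have cH0 : recolor H0 = n by rewrite /recolor mixH0.
  have ssR := supersolvable_restriction DA D_unmixed a1 an1.
  apply: (@ind_factored_step _ _ _ _ _ H0) => //.
  - split=> [H H' _ _|H HD]; first by rewrite !capvf.
    by rewrite capvf; have [] := arrA H (fsubsetP DA H HD).
  - by rewrite cH0 eH0; have [] := supersolvable_family ssR.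
  - move=> H HD; rewrite cH0 eH0.
    exact: (restriction_to_mixed_surj DA D_unmixed a1 an1).
  - apply: IH.
    + apply/eqP; rewrite -eqSS -cardD (cardfsD1 H0 (D `&` mix)) H0Dm add1n eqSS.
      by apply/eqP; congr (#|` _|); apply/fsetP => H;
        rewrite !(in_fsetI, in_fsetD1) andbA.
    + by apply: fsubset_trans DA; apply: fsubD1set.
    + move=> H HA nm; rewrite in_fsetD1 D_unmixed // andbT.
      by apply: contraNneq nm => ->.
  - by rewrite cH0 eH0; apply: supersolvable_ind_factored.
exists (color_blocks (@recolor n) fullv A).
rewrite -[X in ind_factored_pair _ X]traces_fullv.
exact: (mainD _ A).
Qed.

Lemma Akl_ind_factored l k : (2 <= l)%N -> (l - 2 <= k)%N ->
  inductively_factored fullv (@Akl K l r k zeta).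
Proof.
case: l => [|[|n]] // _; rewrite !subSS subn0 leq_eqVlt => /predU1P[<-|lt_nk].
  exact: Akl_ind_factored_eq_pred2.
exact: Akl_ind_factored_ge_pred.
Qed.

End IntermediateArrangements.

Lemma uniq_map_in_inj (T1 T2 : eqType) (f : T1 -> T2) (s : seq T1) :
  uniq (map f s) -> {in s &, injective f}.
Proof.
elim: s => //= x s IH /andP[fxs us] y z; rewrite !inE.
move=> /predU1P[->|ys] /predU1P[->|zs] // eqf; last exact: IH.
  by case/negP: fxs; rewrite eqf map_f.
by case/negP: fxs; rewrite -eqf map_f.
Qed.

(** * Hyperplanes colored by their blocks in a nice partition *)

Section BlockColoring.
Local Open Scope fset_scope.
Local Open Scope ring_scope.
Variables (K : fieldType) (V : vectType K).
Variables (W : {vspace V}) (A : {fset {vspace V}}) (pi : {fset {fset {vspace V}}}).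
Hypotheses (arrA : is_arrangement W A) (nicepi : nice_partition W A pi).

Definition block (H : {vspace V}) : {fset {vspace V}} :=
  head fset0 [seq B <- pi | H \in (B : {fset {vspace V}})].

Lemma block_eq B H : B \in pi -> H \in B -> block H = B.
Proof.
move=> Bpi HB; have [parpi _ _] := nicepi; rewrite /block.
have : B \in [seq B <- pi | H \in (B : {fset {vspace V}})] by rewrite mem_filter HB.
case def_s: [seq _ <- _ | _] => [|C s] //= _.
have : C \in [seq B <- pi | H \in (B : {fset {vspace V}})] by rewrite def_s mem_head.
rewrite mem_filter => /andP[HC Cpi]; exact: (partition_disjoint parpi Cpi Bpi HC HB).
Qed.

Lemma block_mem H : H \in A -> block H \in pi /\ H \in block H.
Proof.
have [parpi _ _] := nicepi.
by move=> /(partition_mem _ parpi)[B Bpi HB]; rewrite (block_eq Bpi HB).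
Qed.

(** The singleton condition at the flat cut out by [s], with containment expressed on vectors; [H0]
    in [s] keeps this flat different from [W]. *)
Lemma nice_singleton (s : seq {vspace V}) H0 : {subset s <= A} -> H0 \in s ->
  exists H, [/\ H \in A,
    forall x, x \in W -> {in s, forall H' : {vspace V}, x \in H'} -> x \in H &
    forall H1, H1 \in A ->
      (forall x, x \in W -> {in s, forall H' : {vspace V}, x \in H'} -> x \in H1) ->
      block H1 = block H -> H1 = H].
Proof.
move=> sA H0s; have [parpi _ sing] := (nice_partitionP _ arrA).1 nicepi.
pose X := (W :&: \bigcap_(H <- s) H)%VS.
have XP x : reflect (x \in W /\ {in s, forall H' : {vspace V}, x \in H'}) (x \in X).
  rewrite memv_cap memv_bigcap; apply: (iffP andP) => [[-> /allP]//|[-> xs]].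
  by split=> //; apply/allP.
have XW : X <> W.
  have [H0W dW] := arrA (sA _ H0s) => eqX.
  suff : (\dim W <= \dim H0)%N by rewrite dW ltnn.
  by apply: dimvS; rewrite -{1}eqX; apply/subvP => x /XP[_]; apply.
have [B [H [Bpi HB XH HP]]] := sing X (in_lattice_bigcap W sA) XW.
have HA : H \in A by apply/(partition_mem _ parpi); exists B.
exists H; split=> // [x xW xs|H1 H1A xH1 eqb].
  by apply: (subvP XH); apply/XP.
apply: HP; first by rewrite -(block_eq Bpi HB) -eqb; have [] := block_mem H1A.
by apply/subvP => x /XP[]; apply: xH1.
Qed.

(** Independence would give [H1 :: s] codimension [size s + 1], but [H1] adds nothing to the
    intersection of [s], whose codimension is at most [size s]. *)
Lemma nice_not_sub (s : seq {vspace V}) H1 :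
  {subset H1 :: s <= A} -> uniq (map block (H1 :: s)) ->
  ~ (forall x, x \in W -> {in s, forall H : {vspace V}, x \in H} -> x \in H1).
Proof.
move=> sA us subH1; have [parpi indep _] := (nice_partitionP _ arrA).1 nicepi.
have injb := uniq_map_in_inj us.
have tL : partial_transversal pi (H1 :: s).
  split; first exact: map_uniq us.
    by case: parpi => _ _ ->.
  move=> B H H' Bpi Hs H's HB H'B; apply: injb => //.
  by rewrite (block_eq Bpi HB) (block_eq Bpi H'B).
have := indep _ tL.
have -> : (W :&: \bigcap_(H <- H1 :: s) H = W :&: \bigcap_(H <- s) H)%VS.
  apply/vspaceP => x; rewrite !memv_cap !memv_bigcap /=; case xW: (x \in W) => //=.
  case xs: (all _ s); rewrite ?andbF // andbT; apply: subH1 => //.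
  exact/allP.
have hyps : {in s, forall H, (id H <= W)%VS /\ \dim W = (\dim (id H)).+1}.
  by move=> H Hs; apply: arrA; apply: sA; rewrite inE Hs orbT.
have := dim_bigcap_ge hyps (subvv W) => le eqW.
by move: le; rewrite {1}eqW addnS ltnn.
Qed.

(** With [nice_two_blocks], this yields exactly two colors on a rank 2 flat: here at most two, there
    at least two. *)
Lemma nice_not_rainbow H1 H2 H3 : H1 \in A -> H2 \in A -> H3 \in A ->
  (forall x, x \in H2 -> x \in H3 -> x \in H1) ->
  [\/ block H1 = block H2, block H1 = block H3 | block H2 = block H3].
Proof.
move=> H1A H2A H3A sub.
have [|b12] := eqVneq (block H1) (block H2); first by constructor 1.
have [|b13] := eqVneq (block H1) (block H3); first by constructor 2.
have [|b23] := eqVneq (block H2) (block H3); first by constructor 3.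
case: (@nice_not_sub [:: H2; H3] H1).
- by move=> H; rewrite !inE => /or3P[]/eqP->.
- by rewrite /= !inE (negPf b12) (negPf b13) b23.
by move=> x _ xs; apply: sub; apply: xs; rewrite !inE eqxx ?orbT.
Qed.

(** The singleton of the flat shares its color with no other hyperplane through it, and one of [H1],
    [H2] is different from it. *)
Lemma nice_two_blocks H1 H2 : H1 \in A -> H2 \in A -> H1 != H2 ->
  exists H H', [/\ H \in A, H' \in A, (H1 :&: H2 <= H)%VS, (H1 :&: H2 <= H')%VS &
    block H <> block H'].
Proof.
move=> H1A H2A neq.
have sA : {subset [:: H1; H2] <= A} by move=> H; rewrite !inE => /orP[]/eqP->.
have [H [HA subH HP]] := nice_singleton sA (mem_head _ _).
have in12 x : x \in (H1 :&: H2)%VS ->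
    x \in W /\ {in [:: H1; H2], forall H' : {vspace V}, x \in H'}.
  move=> /memv_capP[x1 x2]; have [H1W _] := arrA H1A.
  split; first exact: (subvP H1W).
  by move=> H'; rewrite !inE => /orP[]/eqP->.
have le : (H1 :&: H2 <= H)%VS by apply/subvP => x /in12[]; apply: subH.
have [H' [H'12 neqH']] : exists H', H' \in [:: H1; H2] /\ H' <> H.
  have [eqH|neqH] := eqVneq H1 H; last first.
    by exists H1; rewrite mem_head; split=> //; apply/eqP.
  exists H2; rewrite !inE eqxx orbT; split=> //.
  by apply/eqP; rewrite -eqH eq_sym.
exists H, H'; split=> //; first exact: sA.
  move: H'12; rewrite !inE => /orP[]/eqP->; [exact: capvSl | exact: capvSr].
move=> eqb; apply: neqH'; apply: HP; rewrite ?eqb //; first exact: sA.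
by move=> x _ xs; apply: xs.
Qed.

End BlockColoring.

(** * Color patterns on flats of small rank; non-niceness for [l >= 4] *)

Section NonNice.
Local Open Scope fset_scope.
Local Open Scope ring_scope.
Local Opaque coord_hyp diff_hyp block.
Variables (K : fieldType) (r : nat) (zeta : K) (l k : nat).
Hypotheses (zeta_prim : r.-primitive_root zeta) (r_ge2 : (2 <= r)%N).
Let A := @Akl K l r k zeta.
Let arrA : is_arrangement fullv A := @Akl_arrangement K l r k zeta.
Notation e_ t := (delta_mx 0 t).

(** Members of [A] are recognized below by the basis vectors they avoid: one for a coordinate
    hyperplane, two for a difference. *)
Lemma delta_notin H : H \in A -> exists t, e_ t \notin H.
Proof.
move=> /(Akl_cases zeta_prim)[[i [ik -> _]]|[c [i [j [c1 ltij -> _]]]]].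
  by exists i; rewrite delta_coord_hyp eqxx.
exists i; rewrite delta_diff_hyp ?eqxx ?(root1_neq0 zeta_prim) //.
by rewrite -val_eqE /= ltn_eqF.
Qed.

Lemma two_delta_notin H i j : H \in A -> i != j -> e_ i \notin H -> e_ j \notin H ->
  exists2 c, c ^+ r = 1 & H = diff_hyp c i j.
Proof.
move=> /(Akl_cases zeta_prim)[[a [_ -> _]]|[c [a [b [c1 ltab -> _]]]]] neq.
  rewrite !delta_coord_hyp !negbK => /eqP ei /eqP ej.
  by rewrite ei ej eqxx in neq.
have neqab : a != b by rewrite -val_eqE /= ltn_eqF.
have c0 := root1_neq0 zeta_prim c1.
rewrite !delta_diff_hyp // !negb_and !negbK.
move=> /orP[]/eqP ei /orP[]/eqP ej; subst i j.
- by rewrite eqxx in neq.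
- by exists c.
- by exists c^-1; [exact: root1V | exact: diff_hyp_sym].
- by rewrite eqxx in neq.
Qed.

Lemma one_delta_notin H m : H \in A -> (forall t, t != m -> e_ t \in H) ->
  (m < k)%N /\ H = coord_hyp K m.
Proof.
move=> /(Akl_cases zeta_prim)[[a [ak -> _]]|[c [a [b [c1 ltab -> _]]]]] Hm.
  have [<-//|/Hm] := eqVneq a m; by rewrite delta_coord_hyp eqxx.
have neqab : a != b by rewrite -val_eqE /= ltn_eqF.
have c0 := root1_neq0 zeta_prim c1.
have [ea|/Hm] := eqVneq a m; last by rewrite delta_diff_hyp // eqxx.
have : e_ b \in diff_hyp c a b by apply: Hm; rewrite -ea eq_sym.
by rewrite delta_diff_hyp // eqxx andbF.
Qed.

Definition dvec (c : K) (i j : 'I_l) : 'rV[K]_l := c *: e_ i + e_ j.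

Lemma dvecE c i j t : dvec c i j 0 t = c * (t == i)%:R + (t == j)%:R.
Proof. by rewrite !mxE eqxx. Qed.

(** As c is nonzero, [H] contains both basis vectors or neither. If neither, its equation is x_i = d
    x_j, and [dvec c i j] gives d = c. *)
Lemma dvec_mem H c i j : H \in A -> i != j -> c ^+ r = 1 -> dvec c i j \in H ->
  H = diff_hyp c i j \/ (e_ i \in H /\ e_ j \in H).
Proof.
move=> HA neq c1 vH; have c0 := root1_neq0 zeta_prim c1.
have eqij : (e_ i \in H) = (e_ j \in H).
  apply/idP/idP => eH.
    by rewrite -[e_ j](addKr (c *: e_ i)) addrC memvD ?memvN ?memvZ.
  rewrite -[e_ i](scalerK c0) memvZ // -[_ *: e_ i](addrK (e_ j)).
  by rewrite memvB.
case eiH : (e_ i \in H); first by right; rewrite -eqij.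
left; have njH : e_ j \notin H by rewrite -eqij eiH.
have niH : e_ i \notin H by rewrite eiH.
have [d d1 eH] := two_delta_notin HA neq niH njH.
move: vH; rewrite eH => /diff_hypP; rewrite !dvecE !eqxx [j == i]eq_sym (negPf neq).
by rewrite mulr1 mulr0 addr0 add0r mulr1 => ->.
Qed.

Lemma coord_hyp_neq_diff i j c m : m != i -> m != j -> i != j -> c ^+ r = 1 ->
  coord_hyp K m != diff_hyp c i j :> {vspace 'rV[K]_l}.
Proof.
move=> mi mj ij c1; apply/eqP => /vspaceP/(_ (e_ m)).
rewrite delta_coord_hyp eqxx delta_diff_hyp ?(root1_neq0 zeta_prim) //.
by rewrite mi mj.
Qed.

Lemma diff_hyp_neq i j i' j' c c' : i != j -> i' != j' -> i != i' -> i != j' ->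
  c ^+ r = 1 -> c' ^+ r = 1 ->
  diff_hyp c i j != diff_hyp c' i' j' :> {vspace 'rV[K]_l}.
Proof.
move=> ij ij' ii' ij2 c1 c'1; apply/eqP => /vspaceP/(_ (e_ i)).
by rewrite !delta_diff_hyp ?(root1_neq0 zeta_prim) // eqxx ii' ij2.
Qed.

Lemma diff_hyp_inj i j c c' : i != j ->
  diff_hyp c i j = diff_hyp c' i j :> {vspace 'rV[K]_l} -> c = c'.
Proof.
move=> ij /vspaceP/(_ (dvec c i j)) eqH.
have : dvec c i j \in diff_hyp c i j.
  apply/diff_hypP; rewrite !dvecE !eqxx [j == i]eq_sym (negPf ij).
  by rewrite mulr1 mulr0 addr0 add0r mulr1.
rewrite eqH => /diff_hypP; rewrite !dvecE !eqxx [j == i]eq_sym (negPf ij).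
by rewrite mulr1 mulr0 addr0 add0r mulr1.
Qed.

(** The flat contains a vector [w] with entries c d, d, 1 at i, j, m. None vanishes, so [H] is no
    coordinate hyperplane among these; it involves two of the three coordinates, and [w] determines
    the root. *)
Lemma triangle_localization c d i j m H : c ^+ r = 1 -> d ^+ r = 1 ->
  uniq [:: i; j; m] -> H \in A -> (diff_hyp c i j :&: diff_hyp d j m <= H)%VS ->
  [\/ H = diff_hyp c i j, H = diff_hyp d j m | H = diff_hyp (c * d) i m].
Proof.
move=> c1 d1 uijm HA /subvP le; move: uijm.
rewrite /= !inE !negb_or => /and3P[/andP[ij im] jm _].
have c0 := root1_neq0 zeta_prim c1; have d0 := root1_neq0 zeta_prim d1.
pose w : 'rV[K]_l := (c * d) *: e_ i + d *: e_ j + e_ m.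
have wE t : w 0 t = c * d * (t == i)%:R + d * (t == j)%:R + (t == m)%:R.
  by rewrite !mxE eqxx.
have wi : w 0 i = c * d by rewrite wE eqxx (negPf ij) (negPf im) !(mulr0, mulr1, addr0).
have wj : w 0 j = d.
  by rewrite wE eqxx [j == i]eq_sym (negPf ij) (negPf jm) !(mulr0, mulr1, addr0, add0r).
have wm : w 0 m = 1.
  rewrite wE eqxx ![m == _]eq_sym (negPf im) (negPf jm).
  by rewrite !(mulr0, mulr1, addr0, add0r).
have wH : w \in H.
  apply: le; apply/memv_capP; split; apply/diff_hypP.
    by rewrite wi wj.
  by rewrite wj wm mulr1.
have eu u : u != i -> u != j -> u != m -> e_ u \in H.
  move=> ui uj um; apply: le; apply/memv_capP; split.
    by rewrite delta_diff_hyp ?ui ?uj.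
  by rewrite delta_diff_hyp ?uj ?um.
have not_coord a : a \in [:: i; j; m] -> H <> coord_hyp K a.
  move=> aijm eH; move: wH; rewrite eH => /coord_hypP/eqP; apply/negP.
  by move: aijm; rewrite !inE => /or3P[]/eqP->;
    rewrite ?wi ?wj ?wm ?oner_eq0 ?mulf_neq0.
have in_ijm a : {in [:: i; j; m], forall u, u != a -> e_ u \in H} ->
    a \in [:: i; j; m] -> False.
  move=> uH aijm; apply: (not_coord a aijm).
  apply: (one_delta_notin HA _).2 => u ua.
  have [ui|ui] := eqVneq u i; first by apply: uH; rewrite // !inE ui eqxx.
  have [uj|uj] := eqVneq u j; first by apply: uH; rewrite // !inE uj eqxx orbT.
  have [um|um] := eqVneq u m; first by apply: uH; rewrite // !inE um eqxx !orbT.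
  exact: eu.
have [iH|ni] := boolP (e_ i \in H); have [jH|nj] := boolP (e_ j \in H).
- case: (in_ijm m); last by rewrite !inE eqxx !orbT.
  by move=> u; rewrite !inE => /or3P[]/eqP->; rewrite ?eqxx.
- have [mH|nm] := boolP (e_ m \in H).
    case: (in_ijm j); last by rewrite !inE eqxx !orbT.
    by move=> u; rewrite !inE => /or3P[]/eqP->; rewrite ?eqxx.
  have [e e1 eH] := two_delta_notin HA jm nj nm.
  move: wH; rewrite eH => /diff_hypP; rewrite wj wm mulr1 => ->.
  by constructor 2.
- have [mH|nm] := boolP (e_ m \in H).
    case: (in_ijm i); last by rewrite !inE eqxx.
    by move=> u; rewrite !inE => /or3P[]/eqP->; rewrite ?eqxx.
  have [e e1 eH] := two_delta_notin HA im ni nm.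
  move: wH; rewrite eH => /diff_hypP; rewrite wi wm mulr1 => ->.
  by constructor 3.
- have [e e1 eH] := two_delta_notin HA ij ni nj.
  move: wH; rewrite eH => /diff_hypP; rewrite wi wj => /(mulIf d0) ->.
  by constructor 1.
Qed.

Section Coloring.
Variable pi : {fset {fset {vspace 'rV[K]_l}}}.
Hypothesis nicepi : nice_partition fullv A pi.
Notation col c i j := (block pi (diff_hyp c i j)).

Let diffA c i j : c ^+ r = 1 -> i != j -> diff_hyp c i j \in A :=
  fun c1 ij => diff_Akl zeta_prim k c1 ij.

(** No third hyperplane contains the intersection of these two, so the two colors of that flat are
    theirs. *)
Lemma color_disjoint c d (i j m t : 'I_l) : c ^+ r = 1 -> d ^+ r = 1 ->
  uniq [:: i; j; m; t] -> col c i j <> col d m t.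
Proof.
move=> c1 d1; rewrite /= !inE !negb_or => /and4P[/and3P[ij im it] /andP[jm jt] mt _].
have neq : diff_hyp c i j != diff_hyp d m t by apply: diff_hyp_neq.
have [H [H' [HA H'A le le' neqb]]] :=
  nice_two_blocks arrA nicepi (diffA c1 ij) (diffA d1 mt) neq.
have cases H1 : H1 \in A -> (diff_hyp c i j :&: diff_hyp d m t <= H1)%VS ->
    H1 = diff_hyp c i j \/ H1 = diff_hyp d m t.
  move=> H1A /subvP le1.
  have v1 : dvec c i j \in H1.
    apply: le1; apply/memv_capP; split; apply/diff_hypP; rewrite !dvecE ?eqxx.
      by rewrite [j == i]eq_sym (negPf ij) mulr1 mulr0 addr0 add0r mulr1.
    rewrite ![m == _]eq_sym ![t == _]eq_sym.
    by rewrite (negPf im) (negPf jm) (negPf it) (negPf jt) !(mulr0, addr0).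
  have v2 : dvec d m t \in H1.
    apply: le1; apply/memv_capP; split; apply/diff_hypP; rewrite !dvecE ?eqxx.
      by rewrite (negPf im) (negPf jm) (negPf it) (negPf jt) !(mulr0, addr0).
    by rewrite [t == m]eq_sym (negPf mt) mulr1 mulr0 addr0 add0r mulr1.
  have [->|[iH jH]] := dvec_mem H1A ij c1 v1; first by left.
  have [->|[mH tH]] := dvec_mem H1A mt d1 v2; first by right.
  have [u /negP[]] := delta_notin H1A.
  have [->//|ui] := eqVneq u i; have [->//|uj] := eqVneq u j.
  have [->//|um] := eqVneq u m; have [->//|ut] := eqVneq u t.
  apply: le1; apply/memv_capP; rewrite !delta_diff_hyp ?(root1_neq0 zeta_prim) //.
  by rewrite ui uj um ut.
move=> eqcol; apply: neqb.
by case: (cases H HA le) => ->; case: (cases H' H'A le') => ->.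
Qed.

Lemma color_coord_disjoint c (i j m : 'I_l) : c ^+ r = 1 -> (m < k)%N ->
  uniq [:: i; j; m] -> col c i j <> block pi (coord_hyp K m).
Proof.
move=> c1 mk; rewrite /= !inE !negb_or => /and3P[/andP[ij im] jm _].
have neq : coord_hyp K m != diff_hyp c i j.
  by apply: coord_hyp_neq_diff; rewrite // eq_sym.
have [H [H' [HA H'A le le' neqb]]] :=
  nice_two_blocks arrA nicepi (coord_Akl zeta_prim mk) (diffA c1 ij) neq.
have cases H1 : H1 \in A -> (coord_hyp K m :&: diff_hyp c i j <= H1)%VS ->
    H1 = diff_hyp c i j \/ H1 = coord_hyp K m.
  move=> H1A /subvP le1.
  have v1 : dvec c i j \in H1.
    apply: le1; apply/memv_capP; split; last first.
      apply/diff_hypP; rewrite !dvecE ?eqxx.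
      by rewrite [j == i]eq_sym (negPf ij) mulr1 mulr0 addr0 add0r mulr1.
    apply/coord_hypP; rewrite dvecE ![m == _]eq_sym (negPf im) (negPf jm).
    by rewrite mulr0 addr0.
  have [->|[iH jH]] := dvec_mem H1A ij c1 v1; first by left.
  right; apply: (one_delta_notin H1A _).2 => u um.
  have [->//|ui] := eqVneq u i; have [->//|uj] := eqVneq u j.
  apply: le1; apply/memv_capP; split; first by rewrite delta_coord_hyp.
  by rewrite delta_diff_hyp ?ui ?uj ?(root1_neq0 zeta_prim).
move=> eqcol; apply: neqb.
by case: (cases H HA le) => ->; case: (cases H' H'A le') => ->.
Qed.

Lemma color_triangle c d (i j m : 'I_l) : c ^+ r = 1 -> d ^+ r = 1 -> uniq [:: i; j; m] ->
  [\/ col (c * d) i m = col c i j, col (c * d) i m = col d j m |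
      col c i j = col d j m].
Proof.
move=> c1 d1; rewrite /= !inE !negb_or => /and3P[/andP[ij im] jm _].
apply: (nice_not_rainbow arrA nicepi); rewrite ?diffA //.
  exact: root1M.
move=> x /diff_hypP xi /diff_hypP xj; apply/diff_hypP.
by rewrite xi xj mulrA.
Qed.

Lemma color_triangle_neq c d (i j m : 'I_l) : c ^+ r = 1 -> d ^+ r = 1 ->
  uniq [:: i; j; m] ->
  col c i j = col d j m -> col (c * d) i m = col d j m -> False.
Proof.
move=> c1 d1 uijm cd cdm; move: (uijm).
rewrite /= !inE !negb_or => /and3P[/andP[ij im] jm _].
have neq : diff_hyp c i j != diff_hyp d j m by apply: diff_hyp_neq.
have [H [H' [HA H'A le le' neqb]]] :=
  nice_two_blocks arrA nicepi (diffA c1 ij) (diffA d1 jm) neq.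
have cases H1 : H1 \in A -> (diff_hyp c i j :&: diff_hyp d j m <= H1)%VS ->
    block pi H1 = col d j m.
  by move=> H1A le1; case: (triangle_localization c1 d1 uijm H1A le1) => ->.
by apply: neqb; rewrite (cases H HA le) (cases H' H'A le').
Qed.

(** The roots 1 and [zeta] differ, so the flat is x_i = x_j = 0. With x_i = 0 absent, its two colors
    come from the E_ij(c) and, if present, x_j = 0. *)
Lemma pair_color_cases (i j : 'I_l) : i != j -> (k <= i)%N ->
  (exists c d, [/\ c ^+ r = 1, d ^+ r = 1 & col c i j <> col d i j]) \/
  (j < k)%N /\ exists2 c, c ^+ r = 1 & col c i j <> block pi (coord_hyp K j).
Proof.
move=> ij ki; have z1 := root1_zeta zeta_prim; have zn1 := zeta_neq1 zeta_prim r_ge2.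
have one1 : 1 ^+ r = 1 :> K by rewrite expr1n.
have neq : diff_hyp 1 i j != diff_hyp zeta i j :> {vspace 'rV[K]_l}.
  by apply: contra zn1 => /eqP/(diff_hyp_inj ij) <-.
have [H [H' [HA H'A le le' neqb]]] :=
  nice_two_blocks arrA nicepi (diffA one1 ij) (diffA z1 ij) neq.
have cases H1 : H1 \in A -> (diff_hyp 1 i j :&: diff_hyp zeta i j <= H1)%VS ->
    (exists2 c, c ^+ r = 1 & H1 = diff_hyp c i j) \/ (j < k)%N /\ H1 = coord_hyp K j.
  move=> H1A /subvP le1.
  have eu u : u != i -> u != j -> e_ u \in H1.
    move=> ui uj; apply: le1; apply/memv_capP.
    rewrite !delta_diff_hyp ?oner_eq0 ?(root1_neq0 zeta_prim) //.
    by rewrite ui uj.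
  have [iH|niH] := boolP (e_ i \in H1).
    right; apply: one_delta_notin => // u uj.
    by have [->//|ui] := eqVneq u i; apply: eu.
  have [jH|njH] := boolP (e_ j \in H1).
    have [] : (i < k)%N /\ H1 = coord_hyp K i.
      apply: one_delta_notin => // u ui.
      by have [->//|uj] := eqVneq u j; apply: eu.
    by rewrite ltnNge ki.
  by left; apply: two_delta_notin.
case: (cases H HA le) => [[c c1 eH]|[jk eH]];
  case: (cases H' H'A le') => [[d d1 eH']|[jk' eH']].
- by left; exists c, d; rewrite -eH -eH'.
- by right; split=> //; exists c => //; rewrite -eH -eH'.
- by right; split=> //; exists d => //; rewrite -eH -eH'; apply: nesym.
- by case: neqb; rewrite eH eH'.
Qed.

Definition has_color x i j := exists2 c, c ^+ r = 1 & col c i j = x.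

Lemma has_color_sym x i j : has_color x i j -> has_color x j i.
Proof.
move=> [c c1 cx]; exists c^-1; first exact: root1V.
by rewrite -diff_hyp_sym // (root1_neq0 zeta_prim).
Qed.

(** The color of E_ij(s) is absent from im and jm, so each triangle through it gives E_im(s e) and
    E_jm(e) the same color. The pairs im and jm thus have the same colors, and ij must still acquire
    one of them. *)
Lemma common_color_of_singleton s (i j m : 'I_l) : s ^+ r = 1 -> uniq [:: i; j; m] ->
  (k <= i)%N -> (k <= j)%N -> (k <= m)%N ->
  (forall e, e ^+ r = 1 -> col e j m <> col s i j /\ col e i m <> col s i j) ->
  exists x, [/\ has_color x i j, has_color x i m & has_color x j m].
Proof.
move=> s1 uijm ki kj km sing; move: (uijm).
rewrite /= !inE !negb_or => /and3P[/andP[ij im] jm _].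
have same e : e ^+ r = 1 -> col (s * e) i m = col e j m.
  move=> e1; have [nj _] := sing e e1; have [_ ni] := sing _ (root1M s1 e1).
  by case: (color_triangle s1 e1 uijm) => // eqc; case: nj; rewrite eqc.
have [[e [e' [e1 e'1 nee']]]|[]] := pair_color_cases jm kj; last by rewrite ltnNge km.
have e0 := root1_neq0 zeta_prim e1.
(* Chosen so that c e = s e': in the triangle of E_ij(c) and E_jm(e), the third side has the color
   of E_jm(e'), different from that of E_jm(e), and E_ij(c) must take one of the two. *)
pose c := s * e' / e.
have c1 : c ^+ r = 1 by apply: root1M; [exact: root1M | exact: root1V].
have ce : c * e = s * e' by rewrite divfK.
have := color_triangle c1 e1 uijm; rewrite ce same // => -[] eqc.
- exists (col e' j m); split; first by exists c.
    by exists (s * e'); [exact: root1M | exact: same].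
  by exists e'.
- by case: nee'.
- exists (col e j m); split; first by exists c.
    by exists (s * e); [exact: root1M | exact: same].
  by exists e.
Qed.

(** With k <= i, j, m no coordinate hyperplane contains the flat, so its singleton involves two of
    the three coordinates; up to renaming them it is the E_ij(s) of the previous lemma. *)
Lemma common_color (i j m : 'I_l) : uniq [:: i; j; m] ->
  (k <= i)%N -> (k <= j)%N -> (k <= m)%N ->
  exists x, [/\ has_color x i j, has_color x i m & has_color x j m].
Proof.
move=> uijm ki kj km; move: (uijm).
rewrite /= !inE !negb_or => /and3P[/andP[ij im] jm _].
have z1 := root1_zeta zeta_prim; have zn1 := zeta_neq1 zeta_prim r_ge2.
have one1 : 1 ^+ r = 1 :> K by rewrite expr1n.
pose s := [:: diff_hyp 1 i j; diff_hyp zeta i j; diff_hyp 1 j m].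
have sA : {subset s <= A} by apply/allP; rewrite /= !diffA.
have [H [HA subH HP]] := nice_singleton arrA nicepi sA (mem_head _ _).
have inX (x : 'rV[K]_l) : {in s, forall H' : {vspace 'rV[K]_l}, x \in H'} ->
    [/\ x 0 i = 0, x 0 j = 0 & x 0 m = 0].
  move=> xs.
  have /diff_hypP x1 : x \in diff_hyp 1 i j by apply: xs; rewrite !inE eqxx.
  have /diff_hypP x2 : x \in diff_hyp zeta i j by apply: xs; rewrite !inE eqxx orbT.
  have /diff_hypP x3 : x \in diff_hyp 1 j m by apply: xs; rewrite !inE eqxx !orbT.
  have xj : x 0 j = 0.
    apply/eqP; have /eqP := etrans (esym x2) x1.
    rewrite -subr_eq0 -mulrBl mulf_eq0 subr_eq0 (negPf zn1) //.
  by split=> //; [rewrite x1 xj mulr0 | rewrite -[x 0 m]mul1r -x3].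
have uP (a b : 'I_l) c : uniq [:: a; b] -> a \in [:: i; j; m] -> b \in [:: i; j; m] ->
    c ^+ r = 1 -> col c a b = block pi H -> diff_hyp c a b = H.
  rewrite /= inE andbT => ab aijm bijm c1; apply: HP; first exact: diffA.
  move=> x _ /inX[xi xj xm]; apply/diff_hypP.
  by move: aijm bijm; rewrite !inE => /or3P[]/eqP-> /or3P[]/eqP->;
    rewrite ?xi ?xj ?xm mulr0.
have eu u : u != i -> u != j -> u != m -> e_ u \in H.
  move=> ui uj um; apply: subH; first exact: memvf.
  by move=> H'; rewrite !inE => /or3P[]/eqP->;
    rewrite delta_diff_hyp ?ui ?uj ?um ?oner_eq0 ?(root1_neq0 zeta_prim).
have sing (a b : 'I_l) c (t : 'I_l) :
    H = diff_hyp c a b -> c ^+ r = 1 -> uniq [:: a; b; t] ->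
    a \in [:: i; j; m] -> b \in [:: i; j; m] -> t \in [:: i; j; m] ->
    forall e, e ^+ r = 1 -> col e b t <> col c a b /\ col e a t <> col c a b.
  move=> eH c1; rewrite /= !inE !negb_or => /and3P[/andP[ab at_] bt _] ai bi ti e e1.
  split; rewrite -eH => /uP eqH; have := eqH _ _ _ e1; rewrite /= !inE andbT.
    move=> /(_ bt bi ti)/eqP; rewrite eH eq_sym.
    by apply/negP; apply: diff_hyp_neq.
  move=> /(_ at_ ai ti)/eqP; rewrite eH eq_sym diff_hyp_sym ?(root1_neq0 zeta_prim) //.
  apply/negP; apply: diff_hyp_neq; rewrite // ?[b == a]eq_sym //.
  exact: root1V.
have two (a b t : 'I_l) : uniq [:: a; b; t] ->
    a \in [:: i; j; m] -> b \in [:: i; j; m] -> t \in [:: i; j; m] ->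
    (k <= a)%N -> (k <= b)%N -> (k <= t)%N -> e_ a \notin H -> e_ b \notin H ->
    exists x, [/\ has_color x a b, has_color x a t & has_color x b t].
  move=> uabt ai bi ti ka kb kt na nb.
  have ab : a != b by move: uabt; rewrite /= !inE negb_or => /andP[/andP[]].
  have [c c1 eH] := two_delta_notin HA ab na nb.
  apply: (common_color_of_singleton c1) => //; exact: sing.
have at_most (a : 'I_l) :
    {in [:: i; j; m], forall u, u != a -> e_ u \in H} -> (k <= a)%N -> False.
  move=> uH ka; suff [] : (a < k)%N /\ H = coord_hyp K a by rewrite ltnNge ka.
  apply: one_delta_notin => // u ua.
  have [ui|ui] := eqVneq u i; first by apply: uH; rewrite // !inE ui eqxx.
  have [uj|uj] := eqVneq u j; first by apply: uH; rewrite // !inE uj eqxx orbT.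
  have [um|um] := eqVneq u m; first by apply: uH; rewrite // !inE um eqxx !orbT.
  exact: eu.
have ini : i \in [:: i; j; m] by rewrite !inE eqxx.
have inj : j \in [:: i; j; m] by rewrite !inE eqxx orbT.
have inm : m \in [:: i; j; m] by rewrite !inE eqxx !orbT.
have [iH|ni] := boolP (e_ i \in H); have [jH|nj] := boolP (e_ j \in H);
  have [mH|nm] := boolP (e_ m \in H).
- by case: (at_most i) => // u; rewrite !inE => /or3P[]/eqP->.
- by case: (at_most m) => // u; rewrite !inE => /or3P[]/eqP->; rewrite ?eqxx.
- by case: (at_most j) => // u; rewrite !inE => /or3P[]/eqP->; rewrite ?eqxx.
- have ujmi : uniq [:: j; m; i].
    by rewrite /= !inE negb_or jm ![_ == i]eq_sym ij im.
  have [x [xjm xji xmi]] := two j m i ujmi inj inm ini kj km ki nj nm.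
  by exists x; split=> //; apply: has_color_sym.
- by case: (at_most i) => // u; rewrite !inE => /or3P[]/eqP->; rewrite ?eqxx.
- have uimj : uniq [:: i; m; j].
    by rewrite /= !inE negb_or im ij [m == j]eq_sym jm.
  have [x [xim xij xmj]] := two i m j uimj ini inm inj ki km kj ni nm.
  by exists x; split=> //; apply: has_color_sym.
- exact: two.
- exact: two.
Qed.

Lemma not_nice_four (i j m t : 'I_l) : uniq [:: i; j; m; t] ->
  (k <= i)%N -> (k <= j)%N -> (k <= m)%N -> False.
Proof.
move=> uijmt ki kj km; move: (uijmt).
rewrite /= !inE !negb_or => /and4P[/and3P[ij im it] /andP[jm jt] mt _].
have uijm : uniq [:: i; j; m] by rewrite /= !inE negb_or ij im jm.
have [x [[c1 c1r xij] [d0 d0r xim] [e0 e0r xjm]]] := common_color uijm ki kj km.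
have [s sr zx] : exists2 s, s ^+ r = 1 & col s i j <> x.
  have [[c [d [cr dr ncd]]]|[]] := pair_color_cases ij ki; last by rewrite ltnNge kj.
  have [eqc|/eqP nc] := eqVneq (col c i j) x; last by exists c.
  by exists d => // eqd; apply: ncd; rewrite eqc eqd.
set z := col s i j in zx.
(* All E_ij(n) contain the rank 2 flat x_i = x_j = 0, whose two colors are already [x] and [z]. *)
have ij_xz n : n ^+ r = 1 -> col n i j = x \/ col n i j = z.
  move=> nr; rewrite -xij /z.
  have ns : c1 != s by apply/eqP => eqs; apply: zx; rewrite /z -eqs.
  case: (nice_not_rainbow arrA nicepi (diffA nr ij) (diffA c1r ij) (diffA sr ij)).
  - move=> y /diff_hypP y1 /diff_hypP y2; apply/diff_hypP.
    have /eqP := etrans (esym y1) y2.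
    rewrite -subr_eq0 -mulrBl mulf_eq0 subr_eq0 (negPf ns) /= => /eqP yj.
    by rewrite y1 yj !mulr0.
  - by left.
  - by right.
  - by move=> eqs; case: zx; rewrite /z -eqs.
(* [x] occurs on jm, disjoint from it, and on im, disjoint from jt. *)
have ux a : a ^+ r = 1 -> col a i t <> x.
  move=> ar; rewrite -xjm; apply: color_disjoint => //.
  by rewrite /= !inE !negb_or it ij im ![t == _]eq_sym jt mt jm.
have vx a : a ^+ r = 1 -> col a j t <> x.
  move=> ar; rewrite -xim; apply: color_disjoint => //.
  by rewrite /= !inE !negb_or jt [j == i]eq_sym ij jm ![t == _]eq_sym it mt im.
have wn n a : n ^+ r = 1 -> a ^+ r = 1 -> col n i j <> col a m t.
  by move=> nr ar; apply: color_disjoint.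
(* In the triangle i', m, t the side i'm has color [x]. Were i't colored [z], the side mt would be
   [x] or [z], both of which occur on the disjoint pair ij. *)
have not_z (i' : 'I_l) d a :
    uniq [:: i'; m; t] -> d ^+ r = 1 -> col d i' m = x -> a ^+ r = 1 ->
    col a i' t <> z.
  move=> ui' dr dx ar az; have da1 : (d^-1 * a) ^+ r = 1 by rewrite root1M ?root1V.
  have := color_triangle dr da1 ui'; rewrite mulVKf ?(root1_neq0 zeta_prim) //.
  rewrite az dx => -[] eqc.
  - by case: zx.
  - by case: (wn s (d^-1 * a)).
  - by case: (wn c1 (d^-1 * a)) => //; rewrite xij.
have uz a : a ^+ r = 1 -> col a i t <> z.
  by apply: (not_z i d0) => //; rewrite /= !inE negb_or im it mt.
have vz a : a ^+ r = 1 -> col a j t <> z.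
  by apply: (not_z j e0) => //; rewrite /= !inE negb_or jm jt mt.
have one1 : 1 ^+ r = 1 :> K by rewrite expr1n.
(* The third side E_ij(a / b) is [x] or [z], colors that the other two sides avoid, so these two
   must agree. *)
have eq_uv a b : a ^+ r = 1 -> b ^+ r = 1 -> col a i t = col b j t.
  move=> ar br; have ab1 : (a / b) ^+ r = 1 by rewrite root1M ?root1V.
  have uijt : uniq [:: i; j; t] by rewrite /= !inE negb_or ij it jt.
  have := color_triangle ab1 br uijt; rewrite divfK ?(root1_neq0 zeta_prim) //.
  case=> // eqc; exfalso.
    by case: (ij_xz _ ab1); rewrite -eqc; [apply: ux | apply: uz].
  by case: (ij_xz _ ab1); rewrite eqc; [apply: vx | apply: vz].
set u := col 1 i t.
have ucol a : a ^+ r = 1 -> col a i t = u.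
  by move=> ar; rewrite (eq_uv a 1 ar one1) -(eq_uv 1 1 one1 one1).
(* The flat x_i = x_t = 0 needs a color other than [u], and only x_t = 0 is left to carry it. *)
have [[c [d [cr dr ncd]]]|[tk [c cr]]] := pair_color_cases it ki.
  by apply: ncd; rewrite !ucol.
rewrite ucol // => uw; set w := block pi (coord_hyp K t) in uw.
have wij n : n ^+ r = 1 -> col n i j <> w.
  move=> nr; apply: color_coord_disjoint => //.
  by rewrite /= !inE negb_or ij it jt.
have inA : {subset [:: diff_hyp 1 i t; diff_hyp c1 i j; diff_hyp s i j;
                       coord_hyp K t] <= A}.
  apply/allP; apply/and5P; split=> [||||//].
  - exact: diffA.
  - exact: diffA.
  - exact: diffA.
  - exact: (coord_Akl zeta_prim tk).
(* E_ij(c1), E_ij(s) and x_t = 0 already cut out x_i = x_j = x_t = 0, which lies in E_it(1),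
   although the four colors are distinct. *)
apply: (nice_not_sub arrA nicepi inA); last first.
  move=> y _ ys.
  have /diff_hypP y1 : y \in diff_hyp c1 i j by apply: ys; apply: mem_head.
  have /diff_hypP y2 : y \in diff_hyp s i j.
    by apply: ys; rewrite in_cons mem_head orbT.
  have /coord_hypP y3 : y \in coord_hyp K t.
    by apply: ys; rewrite in_cons in_cons mem_head !orbT.
  have ns : c1 != s by apply/eqP => eqs; apply: zx; rewrite /z -eqs.
  have /eqP := etrans (esym y1) y2.
  rewrite -subr_eq0 -mulrBl mulf_eq0 subr_eq0 (negPf ns) /= => /eqP yj.
  by apply/diff_hypP; rewrite y1 yj y3 !mulr0.
rewrite [map _ _]/= -/u -/z -/w xij /= !inE !negb_or andbT; apply/and3P; split.
- apply/and3P; split; apply/eqP; [exact: ux | exact: uz | exact: uw].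
- apply/andP; split; apply/eqP; first exact: nesym.
  by rewrite -xij; apply: wij.
- by apply/eqP; apply: wij.
Qed.

End Coloring.

Lemma Akl_not_nice : (4 <= l)%N -> (k < l - 2)%N -> ~ nice fullv A.
Proof.
move=> l4 kl [pi nicepi].
have [lt1 lt2 lt3 lt4] : [/\ l - 3 < l, l - 2 < l, l - 1 < l & l - 4 < l]%N.
  by split; lia.
apply: (@not_nice_four pi nicepi (Ordinal lt1) (Ordinal lt2)
          (Ordinal lt3) (Ordinal lt4)).
- by rewrite /= !inE -!val_eqE /=; lia.
- by rewrite /=; lia.
- by rewrite /=; lia.
- by rewrite /=; lia.
Qed.

End NonNice.

(** * Failure of bijectivity of the restriction map for [r >= 3] *)

Section NotInductivelyFactored.
Local Open Scope fset_scope.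
Local Open Scope ring_scope.
Local Opaque coord_hyp diff_hyp block.
Variables (K : fieldType) (r : nat) (zeta : K) (l k : nat).
Hypotheses (zeta_prim : r.-primitive_root zeta) (r_ge3 : (3 <= r)%N).
Let A := @Akl K l r k zeta.
Let arrA : is_arrangement fullv A := @Akl_arrangement K l r k zeta.
Let r_ge2 : (2 <= r)%N := ltnW r_ge3.
Let diffA c (i j : 'I_l) : c ^+ r = 1 -> i != j -> diff_hyp c i j \in A :=
  fun c1 ij => diff_Akl zeta_prim k c1 ij.

Lemma third_root (b b' : K) : exists c, [/\ c ^+ r = 1, c != b & c != b'].
Proof.
have z1 := root1_zeta zeta_prim; have one1 : 1 ^+ r = 1 :> K by rewrite expr1n.
have [n0 n1 n2] : [/\ 1 != zeta, 1 != zeta ^+ 2 & zeta != zeta ^+ 2].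
  have E m n : (m < r)%N -> (n < r)%N -> m != n -> zeta ^+ m != zeta ^+ n.
    by move=> mr nr; rewrite (eq_prim_root_expr zeta_prim) !modn_small.
  by split; [apply: (E 0%N 1%N) | apply: (E 0%N 2%N) | apply: (E 1%N 2%N)] => //;
    apply: ltn_trans r_ge3.
have z2 : zeta ^+ 2 ^+ r = 1 by rewrite exprAC z1 expr1n.
have pick c : c ^+ r = 1 -> (c == b) || (c == b') \/
    exists c, [/\ c ^+ r = 1, c != b & c != b'].
  move=> c1; case: (boolP ((c == b) || (c == b'))); first by left.
  by rewrite negb_or => /andP[cb cb']; right; exists c.
have [h1|//] := pick 1 one1; have [h2|//] := pick _ z1; have [h3|//] := pick _ z2.
by move: h1 h2 h3 n0 n1 n2 => /orP[]/eqP-> /orP[]/eqP-> /orP[]/eqP->; rewrite ?eqxx.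
Qed.

(* Only [x_i = c x_j] for one [c] lies outside the block of [x_i = c0 x_j], so
   the set of [b] with [x_j = b x_m] in that block is stable under [r - 1] of
   the [r] rotations, hence trivial as soon as [r >= 3]. *)
Lemma rho_not_bijective pi (B1 : {fset {vspace 'rV[K]_l}}) c0 (i j m : 'I_l) :
  nice_partition fullv A pi -> B1 \in pi -> c0 ^+ r = 1 ->
  uniq [:: i; j; m] -> (k <= i)%N -> (k <= j)%N -> (k <= m)%N ->
  diff_hyp c0 i j \in B1 -> ~ rho_bijective A B1 (diff_hyp c0 i j).
Proof.
set H0 := diff_hyp c0 i j => nicepi B1pi c0r uijm ki kj km H0B1 [rinj rsurj].
move: (uijm); rewrite /= !inE !negb_or => /and3P[/andP[ij im] jm _].
pose black c a b := block pi (diff_hyp c a b : {vspace 'rV[K]_l}) == B1.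
have c00 := root1_neq0 zeta_prim c0r.
have H0b : black c0 i j by apply/eqP; apply: (block_eq nicepi).
have outP c a b : c ^+ r = 1 -> a != b -> ~~ black c a b -> diff_hyp c a b \in A `\` B1.
  move=> c1 ab nb; rewrite in_fsetD diffA // andbT.
  by apply: contra nb => HB1; apply/eqP; apply: (block_eq nicepi).
have cap_eq (H H' : {vspace 'rV[K]_l}) :
    (forall x, x \in H0 -> (x \in H) = (x \in H')) -> (H :&: H0 = H' :&: H0)%VS.
  move=> eqH; apply/vspaceP => x; apply/memv_capP/memv_capP => -[xH xH0].
    by rewrite -eqH.
  by rewrite eqH.
(* All E_ij(c) other than [H0] have the same trace x_i = x_j = 0 on it, so injectivity leaves at
   most one outside [B1]. *)
have ij_uniq c d : c ^+ r = 1 -> d ^+ r = 1 -> ~~ black c i j -> ~~ black d i j -> c = d.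
  move=> c1 d1 nc nd; apply: (diff_hyp_inj ij); apply: rinj; [exact: outP|exact: outP|].
  apply: cap_eq => x /diff_hypP x0.
  have zero e : ~~ black e i j -> x 0 i = e * x 0 j -> x 0 j = 0.
    move=> ne xe; have cne : c0 != e by apply: contra ne => /eqP <-.
    have /eqP := etrans (esym x0) xe.
    by rewrite -subr_eq0 -mulrBl mulf_eq0 subr_eq0 (negPf cne) /= => /eqP.
  apply/diff_hypP/diff_hypP => xe; rewrite x0.
    by rewrite (zero c) // !mulr0.
  by rewrite (zero d) // !mulr0.
(* E_jm(b) and E_im(c0 b) have the same trace on [H0], so they are not both outside [B1]. *)
have tri b : b ^+ r = 1 -> ~~ black b j m -> black (c0 * b) i m.
  move=> b1 nb; apply/negPn/negP => nim.
  have cb1 : (c0 * b) ^+ r = 1 by apply: root1M.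
  have neq : diff_hyp (c0 * b) i m != diff_hyp b j m :> {vspace 'rV[K]_l}.
    by apply: (diff_hyp_neq zeta_prim).
  case/eqP: neq; apply: rinj; [exact: outP | exact: outP |].
  apply: cap_eq => x /diff_hypP x0.
  apply/diff_hypP/diff_hypP; rewrite x0 => xe; last by rewrite xe mulrA.
  by apply: (mulfI c00); rewrite xe mulrA.
(* A triangle is never of one color, so E_im(c b) is outside [B1]; then [tri] puts E_jm(c b / c0)
   into [B1]. *)
have shift c b : c ^+ r = 1 -> b ^+ r = 1 -> black c i j -> black b j m ->
    black (c * b / c0) j m.
  move=> c1 b1 /eqP cb /eqP bb; apply/negPn/negP => /tri.
  have -> : c0 * (c * b / c0) = c * b by rewrite mulrC divfK.
  have cbr : (c * b / c0) ^+ r = 1.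
    by apply: root1M; [exact: root1M | exact: root1V].
  move=> /(_ cbr)/eqP cbb.
  by apply: (color_triangle_neq zeta_prim nicepi c1 b1 uijm); rewrite bb.
(* Otherwise [tri] would put every E_im into [B1], whereas the pair im has two colors. *)
have two_im : exists2 b, b ^+ r = 1 & black b j m.
  have [[c [d [c1 d1 ncd]]]|[]] :=
    pair_color_cases zeta_prim r_ge2 nicepi im ki; last first.
    by rewrite ltnNge km.
  have [bc|nbc] := boolP (black (c / c0) j m).
    by exists (c / c0) => //; apply: root1M => //; apply: root1V.
  have [bd|nbd] := boolP (black (d / c0) j m).
    by exists (d / c0) => //; apply: root1M => //; apply: root1V.
  case: ncd; have -> : c = c0 * (c / c0) by rewrite mulrC divfK.
  have -> : d = c0 * (d / c0) by rewrite mulrC divfK.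
  have /eqP -> := tri _ (root1M c1 (root1V c0r)) nbc.
  by have /eqP -> := tri _ (root1M d1 (root1V c0r)) nbd.
have two_jm : exists2 b, b ^+ r = 1 & ~~ black b j m.
  have [[c [d [c1 d1 ncd]]]|[]] :=
    pair_color_cases zeta_prim r_ge2 nicepi jm kj; last first.
    by rewrite ltnNge km.
  have [bc|nbc] := boolP (black c j m); last by exists c.
  have [bd|nbd] := boolP (black d j m); last by exists d.
  by case: ncd; rewrite (eqP bc) (eqP bd).
case: two_im => b b1 bb; case: two_jm => b' b'1 nb'.
have b0 := root1_neq0 zeta_prim b1; have b'0 := root1_neq0 zeta_prim b'1.
(* c = c0 y / x is the rotation taking x to y, so by [shift] E_ij(c) cannot be in [B1]. A third root
   yields two such rotations, against [ij_uniq]. *)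
have quot x y : x ^+ r = 1 -> y ^+ r = 1 -> black x j m -> ~~ black y j m ->
    (c0 * y / x) ^+ r = 1 /\ ~~ black (c0 * y / x) i j.
  move=> x1 y1 bx ny; have x0 := root1_neq0 zeta_prim x1.
  have q1 : (c0 * y / x) ^+ r = 1.
    by apply: root1M; [exact: root1M | exact: root1V].
  have qE : c0 * y / x * x / c0 = y by rewrite divfK // mulrC mulKf.
  split; first exact: q1.
  by apply: contra ny => bq; have := shift _ x q1 x1 bq bx; rewrite qE.
have [q1 nq] := quot b b' b1 b'1 bb nb'.
have [b'' [b''1 nb nb'']] := third_root b b'.
have b''0 := root1_neq0 zeta_prim b''1.
have [bb''|nbb''] := boolP (black b'' j m).
  have [q2 nq2] := quot b'' b' b''1 b'1 bb'' nb'.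
  have := ij_uniq _ _ q1 q2 nq nq2 => /(mulfI (mulf_neq0 c00 b'0))/invr_inj eqb.
  by rewrite eqb eqxx in nb.
have [q2 nq2] := quot b b'' b1 b''1 bb nbb''.
have := ij_uniq _ _ q1 q2 nq nq2 => /(mulIf (invr_neq0 b0))/(mulfI c00) eqb.
by rewrite eqb eqxx in nb''.
Qed.

End NotInductivelyFactored.

Lemma ind_factored_rho (K : fieldType) (V : vectType K) (W : {vspace V}) A pi :
  ind_factored_pair W A pi ->
  A = fset0 \/ exists B1 H0, [/\ B1 \in pi, H0 \in B1 & rho_bijective A B1 H0].
Proof.
case=> [{}W|{}W {}A {}pi B1 H0 _ _ B1pi H0B1 rbij _ _]; first by left.
by right; exists B1, H0.
Qed.

(** * The arrangement with [l = 3] and [k = 0] *)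

Section RankThree.
Local Open Scope fset_scope.
Local Open Scope ring_scope.
Local Opaque coord_hyp diff_hyp.
Variables (K : fieldType) (r : nat) (zeta : K).
Hypotheses (zeta_prim : r.-primitive_root zeta) (r_ge2 : (2 <= r)%N).
Let A := @Akl K 3 r 0 zeta.
Let arrA : is_arrangement fullv A := @Akl_arrangement K 3 r 0 zeta.

Let i0 : 'I_3 := @Ordinal 3 0 isT.
Let i1 : 'I_3 := @Ordinal 3 1 isT.
Let i2 : 'I_3 := @Ordinal 3 2 isT.

Let diffA c (i j : 'I_3) : c ^+ r = 1 -> i != j -> diff_hyp c i j \in A :=
  fun c1 ij => diff_Akl zeta_prim 0 c1 ij.

Lemma Akl3_not_ind_factored : (2 < r)%N -> ~ inductively_factored fullv A.
Proof.
move=> r3 [pi indpi]; have nicepi := ind_factored_nice indpi.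
have one1 : 1 ^+ r = 1 :> K by rewrite expr1n.
have [A0|[B1 [H0 [B1pi H0B1 rbij]]]] := ind_factored_rho indpi.
  have : diff_hyp 1 i0 i1 \in A by apply: diffA.
  by rewrite A0 in_fset0.
have [parpi _ _] := nicepi.
have H0A : H0 \in A by apply/(partition_mem _ parpi); exists B1.
have [[i []//]|[c [i [j [c1 ltij eH0 _]]]]] := Akl_cases zeta_prim H0A.
(* The indices 0, 1, 2 sum to 3, so this is the remaining coordinate. *)
have ltm : (3 - i - j < 3)%N by have := ltn_ord j; lia.
move: H0B1 rbij; rewrite eH0.
apply: (rho_not_bijective zeta_prim r3 nicepi B1pi c1 (m := Ordinal ltm)) => //.
have := ltn_ord j; rewrite /= !inE -!val_eqE /=; lia.
Qed.

(* The colors 0, 1, 2 are the blocks {x_1 = x_2},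
   {x_1 = c x_2, x_1 = x_3, x_2 = x_3 : c <> 1} and
   {x_1 = c x_3, x_2 = c x_3 : c <> 1}, of sizes 1, r + 1 and 2 r - 2. *)
Definition color3 (H : {vspace 'rV[K]_3}) : nat :=
  ((delta_mx 0%R i2 \notin H) + (const_mx 1%R \notin H))%N.

(** The two tests in [color3] ask whether x_3 occurs and whether c <> 1: the all-ones vector solves
    x_i = c x_j only for c = 1. *)
Lemma color3_cases H : H \in A ->
  (exists2 c, c ^+ r = 1 & H = diff_hyp c i0 i1 /\ color3 H = (c != 1)) \/
  (exists c a, [/\ c ^+ r = 1, a \in [:: i0; i1], H = diff_hyp c a i2 &
     color3 H = (c != 1).+1]).
Proof.
move=> /(Akl_cases zeta_prim)[[i []//]|[c [i [j [c1 ltij eH _]]]]].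
have c0 := root1_neq0 zeta_prim c1.
have neq : i != j by rewrite -val_eqE /= ltn_eqF.
have c1E : (const_mx 1%R \notin H) = (c != 1).
  rewrite eH; congr (~~ _); apply/diff_hypP/eqP; rewrite !mxE mulr1 => //.
have ltj := ltn_ord j.
have [ej|nj] := eqVneq j i2; last first.
  left; exists c => //; move: nj; rewrite -val_eqE /= => nj.
  have ei : i = i0 by apply: val_inj => /=; lia.
  have ej : j = i1 by apply: val_inj => /=; lia.
  by split; rewrite ?eH ?ei ?ej // /color3 -?ei -?ej -eH c1E eH delta_diff_hyp // ei ej.
right; exists c, i; split=> //.
- by move: ltij; rewrite ej !inE -!val_eqE /=; lia.
- by rewrite eH ej.
- by rewrite /color3 c1E eH delta_diff_hyp // -ej eqxx andbF.
Qed.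

Lemma color3_diff01 c : c ^+ r = 1 -> color3 (diff_hyp c i0 i1) = (c != 1).
Proof.
move=> c1; rewrite /color3 delta_diff_hyp ?(root1_neq0 zeta_prim) //.
by congr (nat_of_bool (~~ _)); apply/diff_hypP/eqP; rewrite !mxE mulr1.
Qed.

Lemma color3_diff2 c a : c ^+ r = 1 -> a \in [:: i0; i1] ->
  color3 (diff_hyp c a i2) = (c != 1).+1.
Proof.
move=> c1 a01; rewrite /color3 delta_diff_hyp ?(root1_neq0 zeta_prim) //; last first.
  by move: a01; rewrite !inE => /orP[]/eqP->.
rewrite eqxx andbF /= add1n; congr (nat_of_bool (~~ _)).+1.
by apply/diff_hypP/eqP; rewrite !mxE mulr1.
Qed.

Let zero (d e y : K) : d != e -> d * y = e * y -> y = 0.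
Proof.
by move=> de /eqP; rewrite -subr_eq0 -mulrBl mulf_eq0 subr_eq0 (negPf de) => /eqP.
Qed.

(** If E_12(1) contains X, it is alone in color 0. Otherwise a single color 1 hyperplane through X
    serves; two of them must be E_12(c) and E_a3(1), and then color 2 has exactly one. With no color
    1 hyperplane there is only one hyperplane at all, since two of color 2 would generate one of
    color 0 or 1. *)
Lemma color3_singleton X : X <> fullv -> in_lattice fullv A X ->
  exists H, [/\ H \in A, (X <= H)%VS &
    forall H', H' \in A -> (X <= H')%VS -> color3 H' = color3 H -> H' = H].
Proof.
move=> Xf /(in_latticeP _ arrA)[_ XP].
have one1 : 1 ^+ r = 1 :> K by rewrite expr1n.
have [X01|nX01] := boolP (X <= diff_hyp 1 i0 i1)%VS.
  exists (diff_hyp 1 i0 i1); split=> //; first exact: diffA.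
  move=> H' H'A _; rewrite color3_diff01 // eqxx => cH'.
  have [[c _ [eH' cc]]|[c [a [_ _ _ cc]]]] := color3_cases H'A.
    by move: cH'; rewrite cc eH'; case: eqP => // ->.
  by rewrite cc in cH'.
(* This one vector of X decides which hyperplanes can occur together below. *)
have [x xX x01] : exists2 x, x \in X & x 0 i0 != x 0 i1.
  case/subvPn: nX01 => x xX nx; exists x => //.
  by apply: contra nx => /eqP ex; apply/diff_hypP; rewrite mul1r.
have color_neq0 H : H \in A -> (X <= H)%VS -> color3 H <> 0%N.
  move=> HA XH; have [[c _ [eH ->]]|[c [a [_ _ _ ->]]]] := color3_cases HA => //.
  by case: eqP => // c1 _; case/negP: nX01; rewrite -c1 -eH.
have [a' a'P] : exists a' : 'I_3 -> 'I_3, a' i0 = i1 /\ a' i1 = i0.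
  by exists (fun a => if a == i0 then i1 else i0).
have uniq_color2 (b : K) a H' : x 0 i2 != 0 -> a \in [:: i0; i1] ->
    x 0 a = b * x 0 i2 -> x 0 (a' a) = x 0 i2 ->
    H' \in A -> (X <= H')%VS -> color3 H' = 2%N -> H' = diff_hyp b a i2.
  move=> x2 a01 xa xa' H'A /subvP XH' cH'.
  have [[c _ [_ cc]]|[c [d [_ d01 eH' cc]]]] := color3_cases H'A.
    by move: cH'; rewrite cc; case: eqP.
  have cn1 : c != 1 by move: cH'; rewrite cc; case: eqP.
  have /diff_hypP xd : x \in diff_hyp c d i2 by rewrite -eH'; apply: XH'.
  have [ed|nd] := eqVneq d a.
    have ecb : c = b by apply: (mulIf x2); rewrite -xd -xa ed.
    by rewrite eH' ed ecb.
  have ed : d = a' a.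
    move: a01 d01 nd; rewrite !inE; case: a'P => e0 e1.
    by move=> /orP[]/eqP-> /orP[]/eqP->; rewrite ?eqxx ?e0 ?e1.
  case/eqP: x2; apply: (zero cn1); rewrite -xd ed xa' mul1r //.
have mixed_pair c a : c ^+ r = 1 -> c != 1 -> a \in [:: i0; i1] ->
    (X <= diff_hyp c i0 i1)%VS -> (X <= diff_hyp 1 a i2)%VS ->
    exists H, [/\ H \in A, (X <= H)%VS &
      forall H', H' \in A -> (X <= H')%VS -> color3 H' = color3 H -> H' = H].
  move=> c1 cn1 a01 /subvP Xc /subvP Xa; have c0 := root1_neq0 zeta_prim c1.
  have [b [b1 bn1 Xb]] : exists b, [/\ b ^+ r = 1, b != 1 &
      forall y, y \in X -> y 0 (a' a) = b * y 0 i2].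
    case: a'P => e0 e1; move: a01 Xa; rewrite !inE => /orP[]/eqP-> Xa.
      exists c^-1; split; rewrite ?invr_eq1 //; first exact: root1V.
      move=> y yX; have /diff_hypP := Xa y yX; have /diff_hypP := Xc y yX.
      by rewrite mul1r e0 => -> <-; rewrite mulKf.
    exists c; split=> // y yX; have /diff_hypP := Xa y yX; have /diff_hypP := Xc y yX.
    by rewrite mul1r e1 => -> ->.
  have a'01 : a' a \in [:: i0; i1].
    by case: a'P => e0 e1; move: a01; rewrite !inE => /orP[]/eqP->; rewrite ?e0 ?e1.
  have a'K : a' (a' a) = a.
    by case: a'P => e0 e1; move: a01; rewrite !inE => /orP[]/eqP->; rewrite ?e0 ?e1 ?e0.
  have /diff_hypP xa := Xa x xX; have xa' := Xb x xX; rewrite mul1r in xa.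
  exists (diff_hyp b (a' a) i2); split.
  - by apply: diffA => //; move: a'01; rewrite !inE => /orP[]/eqP->.
  - by apply/subvP => y yX; apply/diff_hypP; apply: Xb.
  move=> H' H'A XH'; rewrite color3_diff2 // bn1 => cH'.
  apply: uniq_color2 => //; last by rewrite a'K.
  apply: contra x01 => /eqP x2; move: xa xa'; rewrite x2 mulr0.
  by case: a'P => e0 e1; move: a01; rewrite !inE => /orP[]/eqP->;
    rewrite ?e0 ?e1 => -> ->.
have x1_neq0 c : x 0 i0 = c * x 0 i1 -> x 0 i1 != 0.
  by move=> xc; apply: contra x01 => /eqP x1; rewrite xc x1 mulr0.
have [/hasP[H1 H1A /andP[XH1 /eqP c1]]|no1] :=
    boolP (has (fun H => (X <= H)%VS && (color3 H == 1%N)) A).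
  have [/hasP[H2 H2A /and3P[XH2 /eqP c2 neq]]|uniq1] :=
      boolP (has (fun H => [&& (X <= H)%VS, color3 H == 1%N & H != H1]) A); last first.
    exists H1; split=> // H' H'A XH' cH'; apply/eqP; apply: contraNT uniq1 => neq.
    by apply/hasP; exists H'; rewrite // XH' cH' c1 eqxx.
  have [[c c1r [eH1 cc]]|[c [a [c1r a01 eH1 cc]]]] := color3_cases H1A;
    have [[d d1r [eH2 cd]]|[d [b [d1r b01 eH2 cd]]]] := color3_cases H2A;
    move: (c1) (c2) (XH1) (XH2); rewrite cc cd eH1 eH2.
  - move=> _ _ /subvP/(_ x xX)/diff_hypP xc /subvP/(_ x xX)/diff_hypP xd.
    have ecd : c = d by apply: (mulIf (x1_neq0 _ xc)); rewrite -xc -xd.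
    by case/eqP: neq; rewrite eH1 eH2 ecd.
  - case: eqP => // /eqP cn1 _; case: eqP => // -> _ Xc Xd.
    exact: mixed_pair Xc Xd.
  - case: eqP => // -> _; case: eqP => // /eqP dn1 _ Xc Xd.
    exact: mixed_pair Xd Xc.
  - case: eqP => // ec _; case: eqP => // ed _.
    move=> /subvP/(_ x xX)/diff_hypP + /subvP/(_ x xX)/diff_hypP.
    rewrite ec ed !mul1r => xa xb.
    have [eab|nab] := eqVneq a b; first by case/eqP: neq; rewrite eH1 eH2 ec ed eab.
    case/eqP: x01; move: a01 b01 nab xa xb; rewrite !inE.
    by move=> /orP[]/eqP-> /orP[]/eqP->; rewrite ?eqxx // => _ -> ->.
have not1 (H : {vspace 'rV[K]_3}) : H \in A -> (X <= H)%VS -> color3 H <> 1%N.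
  by move=> HA XH cH; case/hasP: no1; exists H; rewrite // XH cH.
have color2 H : H \in A -> (X <= H)%VS -> color3 H = 2%N.
  move=> HA XH; have := not1 H HA XH; have := color_neq0 H HA XH.
  by rewrite /color3; do 2!case: (_ \notin H).
have [/hasP[H HA XH]|noH] := boolP (has (fun H => (X <= H)%VS) A); last first.
  case: Xf; apply/vspaceP => v; rewrite memvf; apply: XP; first exact: memvf.
  by move=> H HA XH; case/hasP: noH; exists H.
exists H; split=> // H' H'A XH' _.
have two (H1 : {vspace 'rV[K]_3}) : H1 \in A -> (X <= H1)%VS ->
    exists c a, [/\ c ^+ r = 1, a \in [:: i0; i1] & H1 = diff_hyp c a i2].
  move=> H1A XH1; have := color2 H1 H1A XH1.
  have [[c _ [_ ->]]|[c [a [c1 a01 eH1 _]]]] := color3_cases H1A.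
    by case: eqP.
  by exists c, a.
have [c [a [c1 a01 eH]]] := two H HA XH; have [d [b [d1 b01 eH']]] := two H' H'A XH'.
have c0 := root1_neq0 zeta_prim c1; have d0 := root1_neq0 zeta_prim d1.
have Xa y : y \in X -> y 0 a = c * y 0 i2.
  by move=> yX; apply/diff_hypP; rewrite -eH; apply: (subvP XH).
have Xb y : y \in X -> y 0 b = d * y 0 i2.
  by move=> yX; apply/diff_hypP; rewrite -eH'; apply: (subvP XH').
have [eab|nab] := eqVneq a b.
  have [ecd|ncd] := eqVneq c d; first by rewrite eH eH' ecd eab.
  have a2 : a != i2 by move: a01; rewrite !inE => /orP[]/eqP->.
  case: (@not1 (diff_hyp 1 a i2)); first exact: diffA.
    apply/subvP => y yX; apply/diff_hypP; have := Xb y yX; rewrite -eab Xa // => eqy.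
    by rewrite (zero ncd eqy) !mulr0.
  by rewrite color3_diff2 // eqxx.
have [e [e1 Xe]] : exists e, e ^+ r = 1 /\ forall y, y \in X -> y 0 i0 = e * y 0 i1.
  have cd1 : (c / d) ^+ r = 1 by apply: root1M => //; apply: root1V.
  have dc1 : (d / c) ^+ r = 1 by apply: root1M => //; apply: root1V.
  move: a01 b01 nab Xa Xb; rewrite !inE.
  move=> /orP[]/eqP-> /orP[]/eqP->; rewrite ?eqxx // => _ Xa Xb.
    by exists (c / d); split=> // y yX; rewrite Xa // Xb // mulrA divfK.
  by exists (d / c); split=> // y yX; rewrite Xa // Xb // mulrA divfK.
have X01 : (X <= diff_hyp e i0 i1)%VS by apply/subvP => y yX; apply/diff_hypP; apply: Xe.
have eA : diff_hyp e i0 i1 \in A by apply: diffA.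
by have := color2 _ eA X01; rewrite color3_diff01 //; case: eqP.
Qed.

(** Colors 0 and 2 give x_1 = x_2 = e x_3 with e <> 1. Color 1 then reads x_2 = d x_2 with d <> 1,
    or e x_3 = x_3; either way everything vanishes. *)
Lemma color3_independent (H0 H1 H2 : {vspace 'rV[K]_3}) x :
  H0 \in A -> H1 \in A -> H2 \in A ->
  color3 H0 = 0%N -> color3 H1 = 1%N -> color3 H2 = 2%N ->
  x \in H0 -> x \in H1 -> x \in H2 -> x = 0.
Proof.
move=> H0A H1A H2A k0 k1 k2 xH0 xH1 xH2.
have x01 : x 0 i0 = x 0 i1.
  move: k0 xH0; have [[c _ [-> ->]]|[c [a [_ _ _ ->]]]] := color3_cases H0A => //.
  by case: eqP => // -> _ /diff_hypP; rewrite mul1r.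
have [e [a [e1 en1 a01 xa]]] : exists e a,
    [/\ e ^+ r = 1, e != 1, a \in [:: i0; i1] & x 0 a = e * x 0 i2].
  move: k2 xH2; have [[c _ [_ ->]]|[e [a [e1 a01 -> ->]]]] := color3_cases H2A.
    by case: eqP.
  by case: eqP => // /eqP en1 _ /diff_hypP xa; exists e, a.
have e0 := root1_neq0 zeta_prim e1.
have xab b : b \in [:: i0; i1] -> x 0 b = x 0 a.
  by move: a01; rewrite !inE => /orP[]/eqP-> /orP[]/eqP->.
have x2 : x 0 i2 = 0.
  move: k1 xH1; have [[d _ [-> ->]]|[d [b [_ b01 -> ->]]]] := color3_cases H1A.
    case: eqP => // /eqP dn1 _ /diff_hypP xd; apply: (mulfI e0); rewrite -xa mulr0.
    rewrite -(xab i1) //; rewrite eq_sym in dn1; apply: (zero dn1).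
    by rewrite mul1r -xd x01.
  case: eqP => // -> _ /diff_hypP; rewrite mul1r (xab b b01) => xb.
  by apply: (zero en1); rewrite -xa xb mul1r.
have y0 b : b \in [:: i0; i1] -> x 0 b = 0 by move=> /xab->; rewrite xa x2 mulr0.
apply/rowP => -[[|[|[|//]]] lt]; rewrite mxE.
- by rewrite -(y0 i0) //; congr (x _ _); apply: val_inj.
- by rewrite -(y0 i1) //; congr (x _ _); apply: val_inj.
- by rewrite -x2; congr (x _ _); apply: val_inj.
Qed.

Lemma Akl3_nice : nice fullv A.
Proof.
have one1 : 1 ^+ r = 1 :> K by rewrite expr1n.
have z1 := root1_zeta zeta_prim; have zn1 := zeta_neq1 zeta_prim r_ge2.
have famA : hyperplane_family fullv A.
  split=> [H H' _ _|H HA]; first by rewrite !capvf.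
  by rewrite capvf; have [] := arrA HA.
pose pi := color_blocks color3 fullv A.
have parpi : is_partition pi A.
  by have := color_blocks_partition color3 famA; rewrite traces_fullv.
have fibP n H : (H \in fiber color3 A n) = (H \in A) && (color3 H == n).
  exact: in_fiber.
have inpi H n : H \in A -> color3 H = n -> fiber color3 A n \in pi.
  by move=> HA <-; apply/imfsetP; exists H => //=; rewrite traces_fullv.
exists pi; split=> //; last first.
  move=> X latX Xf; have [H [HA XH HP]] := color3_singleton Xf latX.
  have locP H' : (H' \in localization A X) = (H' \in A) && (X <= H')%VS.
    exact: in_fset_filter.
  exists (fiber color3 A (color3 H) `&` localization A X).
    rewrite in_fsetD1; apply/andP; split.
      apply/fset0Pn; exists H; rewrite in_fsetI fibP HA eqxx /=.
      by rewrite locP HA.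
    by apply/imfsetP; exists (fiber color3 A (color3 H)) => //=; apply: (inpi H).
  apply/eqP/cardfs1P; exists H; apply/fsetP => H'.
  rewrite in_fsetI fibP locP; apply/idP/fset1P => [|->].
    by move=> /and3P[/andP[H'A /eqP cH'] _ XH']; apply: HP.
  by rewrite HA eqxx XH.
have H0A : diff_hyp 1 i0 i1 \in A by apply: diffA.
have H1A : diff_hyp 1 i0 i2 \in A by apply: diffA.
have H2A : diff_hyp zeta i0 i2 \in A by apply: diffA.
have c0 : color3 (diff_hyp 1 i0 i1) = 0%N by rewrite color3_diff01 // eqxx.
have c1 : color3 (diff_hyp 1 i0 i2) = 1%N by rewrite color3_diff2 // eqxx.
have c2 : color3 (diff_hyp zeta i0 i2) = 2%N by rewrite color3_diff2 // zn1.
pose P := fiber color3 A.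
have P0 : P 0%N \in pi := inpi _ _ H0A c0.
have P1 : P 1%N \in pi := inpi _ _ H1A c1.
have P2 : P 2%N \in pi := inpi _ _ H2A c2.
have piE : pi = [fset P 0%N; P 1%N; P 2%N].
  apply/fsetP => B; rewrite !in_fsetE; apply/idP/idP; last first.
    by move=> /orP[/orP[]|]/eqP->.
  move=> /imfsetP[/= H HA ->]; rewrite traces_fullv.
  have : (color3 H <= 2)%N by rewrite /color3; do 2!case: (_ \notin H).
  by case: (color3 H) => [|[|[|]]] // _; rewrite eqxx ?orbT.
have P01 : P 0%N != P 1%N.
  by apply/eqP => /fsetP/(_ (diff_hyp 1 i0 i1)); rewrite !fibP H0A c0.
have P02 : P 0%N != P 2%N.
  by apply/eqP => /fsetP/(_ (diff_hyp 1 i0 i1)); rewrite !fibP H0A c0.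
have P12 : P 1%N != P 2%N.
  by apply/eqP => /fsetP/(_ (diff_hyp 1 i0 i2)); rewrite !fibP H1A c1.
have cardpi : #|` pi| = 3.
  rewrite piE -fsetUA cardfsU1 cardfs2 P12 !in_fsetE negb_or P01 P02 //.
move=> c cP; rewrite cardpi.
have capE : (fullv :&: \bigcap_(B <- pi) c B)%VS = 0%VS.
  apply/eqP; rewrite -subv0; apply/subvP => x; rewrite memv_cap memv_bigcap memv0.
  move=> /andP[_ /allP xP]; apply/eqP.
  have := cP _ P0; have := cP _ P1; have := cP _ P2; rewrite !fibP.
  move=> /andP[A2 /eqP e2] /andP[A1 /eqP e1] /andP[A0 /eqP e0].
  by apply: (color3_independent A0 A1 A2 e0 e1 e2); apply: xP.
by rewrite capE /rank dimv0 subn0 dimvf dim_matrix.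
Qed.

End RankThree.

Local Open Scope complex_scope.

(* The premise (r, l, k) <> (2, 3, 0): that arrangement is the reflection
   arrangement of D_3 = A_3, which is supersolvable, hence inductively factored,
   although k = 0 < l - 2. *)
Theorem theorem3p4 (R : realType) (r l k : nat) (zeta : R[i])
    (r_ge2 : 2 <= r) (l_ge2 : 2 <= l) (k_le_l : k <= l)
    (zeta_prim : r.-primitive_root%R zeta) :
  let A := @Akl R[i] l r k zeta in
  let V := fullv : {vspace 'rV[R[i]]_l} in
  [/\ l = 2 -> inductively_factored V A,
      l = 3 -> nice V A,
      3 <= l -> (r, l, k) <> (2, 3, 0) ->
        (inductively_factored V A <-> l - 2 <= k <= l)
    & 4 <= l -> (nice V A <-> inductively_factored V A)].
Proof.
move=> A V.
have factored : l - 2 <= k -> inductively_factored V A.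
  by move=> le_k; apply: Akl_ind_factored.
have factored_nice : inductively_factored V A -> nice V A.
  by move=> [pi ind_pi]; exists pi; apply: ind_factored_nice.
have not_nice : 4 <= l -> k < l - 2 -> ~ nice V A.
  by move=> l_ge4 lt_k; apply: Akl_not_nice.
split.
- by move=> l2; apply: factored; rewrite l2.
- move=> l3; have [lt0k|] := ltnP 0 k.
    by apply/factored_nice/factored; rewrite l3.
  rewrite leqn0 => /eqP k0; rewrite /V /A; subst l k; exact: Akl3_nice.
- move=> l_ge3 neq; split=> [fA|/andP[le_k _]]; last exact: factored.
  rewrite k_le_l andbT leqNgt; apply/negP => lt_k.
  (* Below rank 4, [k < l - 2] leaves only [l = 3], [k = 0], and the excluded triple then forces
     [r >= 3]. *)
  have [l_ge4|l_lt4] := ltnP 3 l.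
    exact: not_nice (factored_nice fA).
  have [l3 k0] : l = 3 /\ k = 0 by lia.
  subst l k; have r_ge3 : 2 < r.
    by rewrite ltn_neqAle r_ge2 andbT; apply/eqP => r2; case: neq; rewrite r2.
  exact: Akl3_not_ind_factored fA.
- move=> l_ge4; split=> // nA; apply: factored; rewrite leqNgt.
  by apply/negP => lt_k; apply: not_nice.
Qed.
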